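(* Let $I=[0,1]$ and $E=C^\infty(I)$, and let $\varphi:I\times\mathbb{R}\to\mathbb{R}$ be smooth with $\partial_2\varphi(s,\eta)\neq0$ for all $(s,\eta)\in I\times\mathbb{R}$, where $\partial_2$ denotes the partial derivative with respect to the second variable. Let $f:E\to E$ be defined by $f(x)(s)=\varphi(s,x(s))$ for $x\in E$ and $s\in I$. Then $f$ is Colombeau$_0$-tame at every $x\in E$.
   Context: $C^\infty(I)$ is the real vector space of smooth functions $I\to\mathbb{R}$ with its usual Fréchet space topology, given by the seminorms $x\mapsto\sup_{s\in I}|x^{(i)}(s)|$, $i=0,1,2,\dots$. All spaces are real locally convex Hausdorff topological vector spaces; ''bounded'' means von Neumann bounded. Such a space $E$ is locally complete (Mackey complete) if for every closed absolutely convex bounded set $B\subseteq E$, the linear span of $B$, normed by the Minkowski functional of $B$, is a Banach space. Bornological generator: a set $\mathcal{B}$ of nonempty bounded, closed, absolutely convex subsets of $E$ is a bornological generator for $E$ if for all $A,B\in\mathcal{B}$ there is $C\in\mathcal{B}$ with $A\cup B\subseteq C$, and for every bounded $A\subseteq E$ there are a real $t>0$ and $B\in\mathcal{B}$ with $A\subseteq tB$. For $B\in\mathcal{B}$, let $E_B=\{tv:t>0,\ v\in B\}$ be the linear span of $B$. Gateaux differentiable: $f:E\supseteq\operatorname{dom}f\to E$ is Gateaux differentiable if for every $x\in\operatorname{dom}f$ and $v\in E$ one has $x+tv\in\operatorname{dom}f$ for all sufficiently small real $t$, the limit $f'(x)v=\lim_{t\to0}t^{-1}(f(x+tv)-f(x))$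 exists in $E$, and $f'(x):E\to E$ is a continuous linear map. $\mathrm{Colo}_A(f,y_0,\varepsilon,\mathcal{B})$ means: $E$ is bornological and locally complete, $f:E\supseteq\operatorname{dom}f\to E$ is Gateaux differentiable, $\varepsilon$ is a positive real number, $\mathcal{B}$ is a bornological generator for $E$, and for every $B\in\mathcal{B}$ and every $v\in B$, putting $y_1=y_0+2v$, one has $y_1\in\operatorname{dom}f$, $y_1\in E_B$, and $(f'(y_1)-f'(y_0))(B)\subseteq\varepsilon\, f'(y_0)(B)$. $\mathrm{Colo}_0(f,y_0,\varepsilon,\mathcal{B})$ means: $\mathrm{Colo}_A(f,y_0,\varepsilon,\mathcal{B})$ holds and $f'(y_0):E\to E$ is a linear homeomorphism. Colombeau$_0$-tame: $f$ is Colombeau$_0$-tame at $y_0\in E$ if for every $V$ open in the locally convex topology of $E$ with $y_0\in V$ there is some $\mathcal{B}$ such that $\mathrm{Colo}_0(f|_V,y_0,\frac12,\mathcal{B})$ holds, where $f|_V$ is the restriction of $f$ to $V\cap\operatorname{dom}f$. *)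

(* Defs.v *)
From HB Require Import structures.
From mathcomp Require Import all_boot all_order all_algebra.
From mathcomp Require Import all_classical all_reals all_analysis.
From mathcomp Require Import ring lra.

Set Implicit Arguments.
Unset Strict Implicit.
Unset Printing Implicit Defensive.

Import Order.TTheory GRing.Theory Num.Theory.
Import numFieldNormedType.Exports.

Local Open Scope classical_set_scope.
Local Open Scope ring_scope.

Definition unitI (R : realType) : Type := set_type (`[0, 1]%classic : set R).

Section derivative_on_unitI.
Variable R : realType.
Implicit Types (x y : unitI R -> R) (s t : unitI R).

(* Difference quotients taken inside [0, 1], hence one-sided at 0 and 1. *)
Definition diffquotI x s : unitI R -> R :=
  fun t => (x t - x s) / (set_val t - set_val s).

Definition derivI x s : R := lim (diffquotI x s @ s^').

Definition derivableI x := forall s, cvg (diffquotI x s @ s^').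

Definition smoothI x := forall n, derivableI (iter n derivI x).

Lemma nbhsIP s (U : set (unitI R)) :
  nbhs s U <-> exists2 e : R, 0 < e &
    forall t, `|set_val t - set_val s| < e -> U t.
Proof.
rewrite -nbhs_ballE; split.
  move=> [e /= e0 eU]; exists e => // t ts; apply: eU.
  by change (`|set_val s - set_val t| < e); rewrite distrC.
move=> [e e0 eU]; exists e => //= t.
by change (`|set_val s - set_val t| < e -> U t); rewrite distrC; exact: eU.
Qed.

Lemma unitI_itv s : 0 <= set_val s <= (1 : R).
Proof. by have := set_valP s; rewrite /= in_itv. Qed.

Lemma mem_unitI (r : R) : 0 <= r <= 1 -> r \in (`[0, 1]%classic : set R).
Proof. by move=> r01; apply/mem_set; rewrite /= in_itv. Qed.

Definition mkI (r : R) (r01 : 0 <= r <= 1) : unitI R :=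
  SigSub (mem_unitI r01).

Lemma mkIE r r01 : set_val (@mkI r r01) = r.
Proof. by []. Qed.

Global Instance dnbhsI_proper s : ProperFilter s^'.
Proof.
apply: Build_ProperFilter_ex => U /nbhsIP [e e0 eU].
have /andP[s0 s1] := unitI_itv s.
pose d := Num.min (e / 2) (1 / 2).
have d0 : 0 < d by rewrite lt_min; apply/andP; split; lra.
have de : d <= e / 2 by rewrite ge_min lexx.
have d2 : d <= 1 / 2 by rewrite ge_min lexx orbT.
have [sle|slt] := leP (set_val s) (1 / 2).
- have r01 : 0 <= set_val s + d <= 1 by apply/andP; split; lra.
  exists (mkI r01); apply: eU.
    by rewrite mkIE addrAC subrr add0r gtr0_norm//; lra.
  by apply/eqP => /(congr1 set_val); rewrite mkIE; lra.
- have r01 : 0 <= set_val s - d <= 1 by apply/andP; split; lra.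
  exists (mkI r01); apply: eU.
    by rewrite mkIE addrAC subrr add0r normrN gtr0_norm//; lra.
  by apply/eqP => /(congr1 set_val); rewrite mkIE; lra.
Qed.


Lemma derivI_cvg x s (l : R) : diffquotI x s @ s^' --> l -> derivI x s = l.
Proof. by move=> xl; apply: cvg_lim. Qed.

Lemma derivableI_cvg x s : derivableI x ->
  diffquotI x s @ s^' --> derivI x s.
Proof. by move=> /(_ s). Qed.

Lemma cvgI_lin (a : R) x y s (l m : R) :
  diffquotI x s @ s^' --> l -> diffquotI y s @ s^' --> m ->
  diffquotI (fun t => a * x t + y t) s @ s^' --> a * l + m.
Proof.
move=> xl ym.
rewrite (_ : diffquotI _ _ = (fun t => a * diffquotI x s t + diffquotI y s t)).
  by apply: cvgD => //; apply: cvgM => //; exact: cvg_cst.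
by apply/funext => t; rewrite /diffquotI; ring.
Qed.

Lemma derivableI_continuous x : derivableI x -> continuous x.
Proof.
move=> dx s.
have xs : x @ s^' --> x s.
  have : (fun t => diffquotI x s t * (set_val t - set_val s) + x s) @ s^'
      --> derivI x s * 0 + x s.
    apply: cvgD; last exact: cvg_cst.
    apply: cvgM; first exact: derivableI_cvg.
    apply/cvgrPdist_lt => e e0; apply/nbhsIP; exists e => // t ts _.
    by rewrite sub0r normrN.
  rewrite mulr0 add0r; apply: cvg_trans; apply: near_eq_cvg.
  near=> t.
  rewrite /diffquotI divfK ?subrK// subr_eq0.
  have : t != s by near: t; exact: nbhs_dnbhs_neq.
  by apply: contra => /eqP /val_inj ->.
apply/(@cvgrPdist_lt _ _ _ _ (nbhs_filter s)) => e e0.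
move/cvgrPdist_lt: xs => /(_ e e0) /nbhsIP[d d0 h].
apply/nbhsIP; exists d => // t td.
have [->|ts] := eqVneq t s; first by rewrite subrr normr0.
exact: h.
Unshelve. all: by end_near. Qed.

Lemma cvgI_mul x y s (l m : R) : derivableI y ->
  diffquotI x s @ s^' --> l -> diffquotI y s @ s^' --> m ->
  diffquotI (fun t => x t * y t) s @ s^' --> l * y s + x s * m.
Proof.
move=> dy xl ym.
rewrite (_ : diffquotI _ _ =
  (fun t => diffquotI x s t * y t + x s * diffquotI y s t)).
  apply: cvgD; apply: cvgM => //; last exact: cvg_cst.
  by apply: cvg_within_filter; exact: derivableI_continuous.
by apply/funext => t; rewrite /diffquotI; ring.
Qed.

Lemma iter_derivI_lin (a : R) x y n : smoothI x -> smoothI y ->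
  iter n (@derivI) (fun t => a * x t + y t) =
  (fun t => a * iter n (@derivI) x t + iter n (@derivI) y t).
Proof.
move=> sx sy; elim: n => //= n ->; apply/funext => s.
by apply: derivI_cvg; apply: cvgI_lin; apply: derivableI_cvg.
Qed.

Lemma smoothI_lin (a : R) x y : smoothI x -> smoothI y ->
  smoothI (fun t => a * x t + y t).
Proof.
move=> sx sy n; rewrite iter_derivI_lin// => s.
by apply/cvg_ex; eexists; apply: cvgI_lin; apply: derivableI_cvg.
Qed.

Lemma smoothI0 : smoothI (fun=> 0).
Proof.
have d0 s : diffquotI (fun=> 0 : R) s @ s^' --> (0 : R).
  rewrite (_ : diffquotI _ _ = fun=> 0); first exact: cvg_cst.
  by apply/funext => t; rewrite /diffquotI subrr mul0r.
have h n : iter n (@derivI) (fun=> 0) = fun=> 0.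
  by elim: n => //= n ->; apply/funext => s; exact: derivI_cvg.
by move=> n; rewrite h => s; apply/cvg_ex; exists 0.
Qed.

Lemma clampI_itv (r : R) : 0 <= Num.max 0 (Num.min 1 r) <= 1.
Proof. by rewrite le_max lexx /= ge_max ler01 ge_min lexx. Qed.

Definition clampI (r : R) : unitI R := mkI (clampI_itv r).

Lemma clampIE (r : R) : 0 <= r <= 1 -> set_val (clampI r) = r.
Proof.
move=> /andP[r0 r1]; rewrite mkIE.
by rewrite min_r// max_r.
Qed.

Lemma clampIK s : clampI (set_val s) = s.
Proof. by apply: val_inj; rewrite -[LHS]/(set_val _) clampIE// unitI_itv. Qed.

Lemma clampI_lip (a b : R) :
  `|set_val (clampI a) - set_val (clampI b)| <= `|a - b|.
Proof.
rewrite !mkIE.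
wlog ab : a b / a <= b => [h|].
  by have [/h//|/ltW/h] := leP a b; rewrite distrC [leRHS]distrC.
rewrite distrC [leRHS]distrC [leRHS]ger0_norm ?subr_ge0// ger0_norm.
  by rewrite /Num.min /Num.max; do !case: ifPn; lra.
by rewrite subr_ge0 /Num.min /Num.max; do !case: ifPn; lra.
Qed.

Lemma clampI_continuous : continuous clampI.
Proof.
move=> r U /nbhsIP[e e0 eU]; apply/nbhs_ballP; exists e => //= t rt.
by apply: eU; apply: le_lt_trans (clampI_lip _ _) _; rewrite distrC.
Qed.

Lemma continuousI_bounded x : continuous x ->
  exists M : R, forall s, `|x s| <= M.
Proof.
move=> cx.
have cV : continuous (fun r => `|x (clampI r)|).
  move=> r; apply: cvg_norm.
  by apply: continuous_comp; [exact: clampI_continuous|exact: cx].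
have [||c _ h] := @EVT_max R (fun r => `|x (clampI r)|) 0 1.
- exact: ler01.
- exact: continuous_subspaceT.
exists `|x (clampI c)| => s.
by rewrite -[in leLHS](clampIK s); apply: h; rewrite in_itv /= unitI_itv.
Qed.

End derivative_on_unitI.

Section function_space.
Variable R : realType.

Definition smoothIb : {pred (unitI R -> R^o)} := fun x => `[< smoothI x >].

Record smoothfun := SmoothFun {
  smoothfun_val :> unitI R -> R^o;
  _ : smoothfun_val \in smoothIb }.

HB.instance Definition _ := [isSub for smoothfun_val].
HB.instance Definition _ := [Choice of smoothfun by <:].

Lemma smoothI_submod_closed : submod_closed smoothIb.
Proof.
split; first by apply/asboolP; exact: smoothI0.
by move=> a x y /asboolP sx /asboolP sy; apply/asboolP; exact: smoothI_lin.
Qed.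

HB.instance Definition _ :=
  GRing.isSubmodClosed.Build R (unitI R -> R^o) smoothIb smoothI_submod_closed.
HB.instance Definition _ := [SubChoice_isSubLmodule of smoothfun by <:].

Lemma smoothfunP (x : smoothfun) : smoothI x.
Proof. by have /asboolP := valP x. Qed.

Definition Dn n (x : smoothfun) : unitI R -> R := iter n (@derivI R) x.

Definition seminorm n (x : smoothfun) : R :=
  sup (range (fun s => `|Dn n x s|)).


Lemma Dn_ubound n (x : smoothfun) : exists M : R, forall s, `|Dn n x s| <= M.
Proof.
by apply: continuousI_bounded; apply: derivableI_continuous; exact: smoothfunP.
Qed.

Lemma Dn_le_seminorm n (x : smoothfun) s : `|Dn n x s| <= seminorm n x.
Proof.
have [M xM] := Dn_ubound n x.
by apply: ub_le_sup; [exists M => _ [t _ <-]|exists s].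
Qed.

Lemma seminorm_le n (x : smoothfun) (c : R) :
  (forall s, `|Dn n x s| <= c) -> seminorm n x <= c.
Proof.
move=> xc; apply: ge_sup; first by exists `|Dn n x (clampI 0)|, (clampI 0).
by move=> _ [s _ <-].
Qed.

Lemma DnE n (a : R) (x y : smoothfun) s :
  Dn n (a *: x + y) s = a * Dn n x s + Dn n y s.
Proof.
exact: (congr1 (@^~ s)
  (iter_derivI_lin a n (@smoothfunP x) (@smoothfunP y))).
Qed.

Lemma seminorm_ge0 n (x : smoothfun) : 0 <= seminorm n x.
Proof. exact: le_trans (normr_ge0 _) (Dn_le_seminorm n x (clampI 0)). Qed.

Lemma seminormZD n (a : R) (x y : smoothfun) :
  seminorm n (a *: x + y) <= `|a| * seminorm n x + seminorm n y.
Proof.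
apply: seminorm_le => s; rewrite DnE (le_trans (ler_normD _ _))// normrM.
by rewrite lerD ?ler_wpM2l// Dn_le_seminorm.
Qed.

Lemma seminorm0 n : seminorm n 0 = 0.
Proof.
apply/eqP; rewrite eq_le seminorm_ge0 andbT; apply: seminorm_le => s.
have -> : (0 : smoothfun) = (-1) *: 0 + 0 by rewrite scaler0 addr0.
by rewrite DnE mulN1r addNr normr0.
Qed.

Lemma seminormZ n (a : R) (x : smoothfun) :
  seminorm n (a *: x) <= `|a| * seminorm n x.
Proof. by have := seminormZD n a x 0; rewrite addr0 seminorm0 addr0. Qed.

Lemma seminormD n (x y : smoothfun) :
  seminorm n (x + y) <= seminorm n x + seminorm n y.
Proof. by have := seminormZD n 1 x y; rewrite scale1r normr1 mul1r. Qed.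

Lemma seminormN n (x : smoothfun) : seminorm n (- x) = seminorm n x.
Proof.
have h y : seminorm n (- y) <= seminorm n y.
  by rewrite -scaleN1r (le_trans (seminormZ _ _ _))// normrN1 mul1r.
by apply/eqP; rewrite eq_le h /= -{1}[x]opprK h.
Qed.

Definition seminorm_ball (x : smoothfun) (n : nat) (e : R) : set smoothfun :=
  [set y | forall i, (i <= n)%N -> seminorm i (y - x) < e].

(* The locally convex topology generated by the seminorms
   x |-> sup |x^(i)|, i = 0, 1, 2, ... *)
Definition smoothfun_nbhs (x : smoothfun) : set_system smoothfun :=
  [set U | exists n, exists2 e : R, 0 < e & seminorm_ball x n e `<=` U].

HB.instance Definition _ := hasNbhs.Build smoothfun smoothfun_nbhs.

Lemma nbhs_seminorm_ball (x : smoothfun) n (e : R) :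
  0 < e -> nbhs x (seminorm_ball x n e).
Proof. by move=> e0; exists n, e. Qed.

Lemma seminorm_ball_center (x : smoothfun) n (e : R) :
  0 < e -> seminorm_ball x n e x.
Proof. by move=> e0 i _; rewrite subrr seminorm0. Qed.

Lemma seminorm_ballS (x : smoothfun) m n (d e : R) :
  (m <= n)%N -> d <= e -> seminorm_ball x n d `<=` seminorm_ball x m e.
Proof.
by move=> mn de y xy i im; apply: lt_le_trans de; apply: xy; exact: leq_trans mn.
Qed.

Lemma smoothfun_nbhs_filter (x : smoothfun) : ProperFilter (nbhs x).
Proof.
apply: Build_ProperFilter_ex.
  by move=> U [n [e e0 eU]]; exists x; apply: eU; exact: seminorm_ball_center.
split.
- by exists 0%N, 1.
- move=> U V [m [d d0 dU]] [n [e e0 eV]].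
  exists (maxn m n), (Num.min d e); first by rewrite lt_min d0.
  move=> y xy; split; [apply: dU|apply: eV]; apply: seminorm_ballS xy.
  + exact: leq_maxl.
  + by rewrite ge_min lexx.
  + exact: leq_maxr.
  + by rewrite ge_min lexx orbT.
- by move=> U V UV [n [e e0 eU]]; exists n, e => // y /eU /UV.
Qed.

Lemma smoothfun_nbhs_singleton (x : smoothfun) (U : set smoothfun) :
  nbhs x U -> U x.
Proof. by move=> [n [e e0 eU]]; apply: eU; exact: seminorm_ball_center. Qed.

Lemma seminorm_ball_half (x y z : smoothfun) n (e : R) :
  seminorm_ball x n (e / 2) y -> seminorm_ball y n (e / 2) z ->
  seminorm_ball x n e z.
Proof.
move=> xy yz i im; have := xy _ im; have := yz _ im.
rewrite (_ : z - x = (z - y) + (y - x)); last by rewrite addrA subrK.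
by have := seminormD i (z - y) (y - x); lra.
Qed.

Lemma smoothfun_nbhs_nbhs (x : smoothfun) (U : set smoothfun) :
  nbhs x U -> nbhs x (nbhs^~ U).
Proof.
move=> [n [e e0 eU]]; exists n, (e / 2); first by lra.
move=> y xy; exists n, (e / 2); first by lra.
by move=> z yz; apply: eU; exact: seminorm_ball_half yz.
Qed.

HB.instance Definition _ := Nbhs_isNbhsTopological.Build smoothfun
  smoothfun_nbhs_filter smoothfun_nbhs_singleton smoothfun_nbhs_nbhs.

Lemma smoothfun_add_continuous :
  continuous (fun z : smoothfun * smoothfun => z.1 + z.2).
Proof.
move=> [x y] U [n [e e0 eU]].
exists (seminorm_ball x n (e / 2), seminorm_ball y n (e / 2)).
  by split; apply: nbhs_seminorm_ball; lra.
move=> [x' y'] [/= xx yy]; apply: eU => i im.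
rewrite opprD addrACA; have := xx _ im; have := yy _ im.
by have := seminormD i (x' - x) (y' - y); lra.
Qed.

Lemma smoothfun_scale_continuous :
  continuous (fun z : R^o * smoothfun => z.1 *: z.2).
Proof.
move=> [a x] U [n [e e0 eU]].
pose M := \sum_(i < n.+1) seminorm i x + `|a| + 1.
have xM i : (i <= n)%N -> seminorm i x + `|a| + 1 <= M.
  move=> im; rewrite !lerD2r (bigD1 (Ordinal (im : (i < n.+1)%N)))//=.
  by rewrite lerDl sumr_ge0// => j _; exact: seminorm_ge0.
have M0 : 0 < M.
  by have := xM 0%N isT; have := seminorm_ge0 0 x; have := normr_ge0 a; lra.
pose d := Num.min 1 (e / (2 * M)).
have eM0 : 0 < e / (2 * M) by rewrite divr_gt0// mulr_gt0.
have d0 : 0 < d by rewrite lt_min ltr01.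
have d1 : d <= 1 by rewrite ge_min lexx.
have dM : d * M <= e / 2.
  rewrite -ler_pdivlMr// (_ : _ / M = e / (2 * M)); last by field; lra.
  by rewrite ge_min lexx orbT.
exists (ball a d, seminorm_ball x n d).
  by split; [exact: nbhsx_ballx|exact: nbhs_seminorm_ball].
move=> [b y] [/= ab xy]; apply: eU => i im /=.
have {}ab : `|b - a| < d by rewrite distrC.
rewrite (_ : b *: y - a *: x = b *: (y - x) + (b - a) *: x); last first.
  by rewrite scalerBr scalerBl addrA subrK.
apply: le_lt_trans (seminormZD _ _ _ _) _.
apply: le_lt_trans (lerD (lexx _) (seminormZ _ _ _)) _.
have bM : `|b| <= `|a| + 1.
  by rewrite -[b](subrK a) (le_trans (ler_normD _ _))// addrC lerD2l; lra.
have xi := seminorm_ge0 i x; have ai := normr_ge0 a.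
have yi := seminorm_ge0 i (y - x); have yd := xy i im; have Mi := xM i im.
apply: (@le_lt_trans _ _ (d * (seminorm i x + `|a| + 1) - 0)); last first.
  by rewrite subr0 (le_lt_trans (ler_wpM2l (ltW d0) Mi))//; lra.
have h1 : `|b| * seminorm i (y - x) <= (`|a| + 1) * d.
  by apply: ler_pM => //; exact: ltW.
have h2 : `|b - a| * seminorm i x <= d * seminorm i x.
  by apply: ler_wpM2r => //; exact: ltW.
by lra.
Qed.

Lemma seminorm_ball_convex (x : smoothfun) n (e : R) :
  convex_set (seminorm_ball x n e : set (convex_lmodType smoothfun)).
Proof.
apply/convex_setW => y z /set_mem xy /set_mem xz k k0 k1; apply/mem_set.
move=> i im; set l : R := k%:num.
rewrite [X in seminorm i X](_ : _ = l *: (y - x) + (1 - l) *: (z - x)).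
  apply: le_lt_trans (seminormZD _ _ _ _) _.
  apply: le_lt_trans (lerD (lexx _) (seminormZ _ _ _)) _.
  have l0 : 0 < l by [].
  have l1 : 0 < 1 - l by rewrite subr_gt0.
  rewrite (gtr0_norm l0) (gtr0_norm l1).
  rewrite (_ : e = l * e + (1 - l) * e); last by rewrite -mulrDl subrKC mul1r.
  apply: ltrD; first by rewrite (ltr_pM2l l0); exact: xy.
  by rewrite (ltr_pM2l l1); exact: xz.
change (l *: y + (1 - l) *: z - x = l *: (y - x) + (1 - l) *: (z - x)).
rewrite !scalerBr addrACA -opprD -scalerDl subrKC scale1r//.
Qed.

Lemma seminorm_ball_open (x : smoothfun) n (e : R) :
  open (seminorm_ball x n e).
Proof.
rewrite openE => y xy; rewrite /interior.
pose m := \big[Num.max/0]_(i < n.+1) seminorm i (y - x).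
have me : m < e.
  apply/bigmax_ltP; split; last by move=> i _; apply: xy; rewrite -ltnS.
  by apply: le_lt_trans (xy 0%N isT); exact: seminorm_ge0.
exists n, (e - m); first by rewrite subr_gt0.
move=> z yz i im; have := yz i im.
rewrite (_ : z - x = (z - y) + (y - x)); last by rewrite addrA subrK.
have ym : seminorm i (y - x) <= m.
  exact: (le_bigmax _ (fun i : 'I_n.+1 => seminorm i (y - x))
    (Ordinal (im : (i < n.+1)%N))).
by have := seminormD i (z - y) (y - x); lra.
Qed.

Lemma smoothfun_locally_convex : exists2 B : set_system smoothfun,
  (forall b, b \in B -> convex_set b) & basis B.
Proof.
exists [set b | exists x n, exists2 e : R, 0 < e & b = seminorm_ball x n e].
  by move=> b /set_mem[x [n [e e0 ->]]]; exact: seminorm_ball_convex.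
split; first by move=> _ [x [n [e e0 ->]]]; exact: seminorm_ball_open.
move=> x U [n [e e0 eU]]; exists (seminorm_ball x n e) => //=; split.
  by exists x, n, e.
exact: seminorm_ball_center.
Qed.

HB.instance Definition _ := PreTopologicalLmod_isTvs.Build R smoothfun
  smoothfun_add_continuous smoothfun_scale_continuous smoothfun_locally_convex.
HB.instance Definition _ :=
  PreTopologicalNmodule_isTopologicalNmodule.Build smoothfun
    smoothfun_add_continuous.
HB.instance Definition _ :=
  TopologicalNmodule_isTopologicalLmodule.Build R smoothfun
    smoothfun_scale_continuous.
HB.instance Definition _ :=
  Uniform_isTvs.Build R smoothfun smoothfun_locally_convex.

End function_space.

Section smooth_two_variables.
Variable R : realType.
Implicit Types (g : unitI R * R -> R) (x : unitI R -> R).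

Definition partial1 g : unitI R * R -> R :=
  fun z => derivI (fun t => g (t, z.2)) z.1.

Definition partial2 g : unitI R * R -> R :=
  fun z => derive1 (fun e => g (z.1, e)) z.2.

(* [true] stands for the first variable; iterated partial derivatives are taken
   in every order. *)
Definition partials (w : seq bool) g : unitI R * R -> R :=
  foldr (fun b => if b then partial1 else partial2) g w.

Definition cont_partially_diff g :=
  [/\ continuous g,
      forall e, derivableI (fun t => g (t, e)) &
      forall s e, derivable (fun e' => g (s, e') : R) e 1].

(* Smooth up to the boundary: all iterated partial derivatives exist and are
   jointly continuous. *)
Definition smooth2 g := forall w, cont_partially_diff (partials w g).

Lemma smooth2_partial1 g : smooth2 g -> smooth2 (partial1 g).
Proof.
by move=> sg w; have := sg (rcons w true); rewrite /partials foldr_rcons. Qed.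

Lemma smooth2_partial2 g : smooth2 g -> smooth2 (partial2 g).
Proof.
by move=> sg w; have := sg (rcons w false); rewrite /partials foldr_rcons. Qed.

Lemma derivI_is_derive x (r : R) : derivableI x -> 0 < r < 1 ->
  is_derive r 1 (x \o @clampI R) (derivI x (clampI r)).
Proof.
move=> dx /andP[r0 r1].
have rc : set_val (clampI r) = r by rewrite clampIE// !ltW.
have xl : (fun h => h^-1 *: ((x \o @clampI R) (h *: 1 + r) -
    (x \o @clampI R) r)) @ 0^' --> (derivI x (clampI r) : R^o).
  apply/cvgrPdist_lt => e e0.
  have [d d0 h] := (nbhsIP _ _).1 ((@cvgrPdist_lt _ _ _ _ _ _ _).1
    (@derivableI_cvg R x (clampI r) dx) e e0).
  near=> k.
  have k0 : k != 0 by near: k; exact: nbhs_dnbhs_neq.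
  have kd : `|k| < Num.min d (Num.min r (1 - r)).
    by near: k; apply: dnbhs0_lt; rewrite !lt_min d0 r0 subr_gt0.
  move: kd; rewrite !lt_min => /and3P[kd kr kr1].
  have /andP[{}kr _] : - r < k < r by rewrite -ltr_norml.
  have /andP[_ k1] : - (1 - r) < k < 1 - r by rewrite -ltr_norml.
  have kc : set_val (clampI (k + r)) = k + r by rewrite clampIE//; lra.
  rewrite /= [k *: 1]mulr1.
  have := h (clampI (k + r)); rewrite kc rc addrK => /(_ kd).
  have ne : clampI (k + r) != clampI r.
    apply/eqP => /(congr1 set_val); rewrite kc rc => kr0.
    by move/eqP: k0; apply; lra.
  by move=> /(_ ne); rewrite /diffquotI kc rc addrK [_ *: _]mulrC.
apply: DeriveDef; last exact: cvg_lim.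
by apply/cvg_ex; exists (derivI x (clampI r)).
Unshelve. all: by end_near. Qed.

Lemma MVT_unitI x s t : derivableI x -> set_val s <= set_val t :> R ->
  exists c, [/\ set_val s <= set_val c <= (set_val t : R) &
    x t - x s = derivI x c * (set_val t - set_val s)].
Proof.
move=> dx st; have /andP[s0 s1] := unitI_itv s; have /andP[t0 t1] := unitI_itv t.
have [||c] := @MVT_segment R (x \o @clampI R) (derivI x \o @clampI R)
    (set_val s) (set_val t) st.
- move=> r; rewrite in_itv /= => /andP[sr rt].
  by apply: derivI_is_derive => //; lra.
- apply: continuous_subspaceT => r.
  apply: continuous_comp; first exact: clampI_continuous.
  exact: derivableI_continuous.
rewrite in_itv /= !clampIK => /andP[sc ct] xst.
by exists (clampI c); rewrite clampIE ?sc//; lra.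
Qed.

Lemma MVT_unitI_near x s t : derivableI x ->
  exists2 c, `|set_val c - set_val s| <= `|set_val t - set_val s| :> R &
    x t - x s = derivI x c * (set_val t - set_val s).
Proof.
move=> dx; have [st|/ltW ts] := leP (set_val s) (set_val t).
  have [c [/andP[sc ct] xc]] := MVT_unitI dx st; exists c => //.
  by rewrite !ger0_norm; lra.
have [c [/andP[sc ct] xc]] := MVT_unitI dx ts; exists c; last lra.
by rewrite !ler0_norm; lra.
Qed.

Lemma chain_rule x g s : cont_partially_diff g -> continuous (partial1 g) -> derivableI x ->
  diffquotI (fun t => g (t, x t)) s @ s^' -->
    partial1 g (s, x s) + partial2 g (s, x s) * derivI x s.
Proof.
move=> [cg d1 d2] c1 dx.
have cx : x @ s --> x s by exact: derivableI_continuous.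
pose u e := g (s, e).
pose q e := if e == x s then partial2 g (s, x s)
            else (u e - u (x s)) / (e - x s).
have qE e : u e - u (x s) = q e * (e - x s).
  rewrite /q; case: eqVneq => [->|es]; first by rewrite !subrr mulr0.
  by rewrite divfK// subr_eq0.
have q_cvg : q @ x s --> q (x s).
  have : (fun h => h^-1 *: (u (h *: 1 + x s) - u (x s))) @ 0^' -->
      ('D_1 u (x s) : R^o) by exact: d2.
  move=> /cvgrPdist_lt du; apply/cvgrPdist_lt => e e0.
  have [d /= d0 h] := du e e0.
  exists d => //= e' /= ed.
  have [->|ne] := eqVneq e' (x s); first by rewrite subrr normr0.
  have := h (e' - x s); rewrite /ball /= sub0r normrN distrC => /(_ ed).
  rewrite subr_eq0 => /(_ ne); rewrite [_ *: 1]mulr1 subrK.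
  by rewrite /q eqxx (negbTE ne) /partial2 /= derive1E [_ *: _]mulrC.
have g1_cvg : (fun t => (g (t, x t) - g (s, x t)) / (set_val t - set_val s))
    @ s^' --> partial1 g (s, x s).
  apply/cvgrPdist_lt => e e0.
  have /cvgrPdist_lt/(_ e e0) := c1 (s, x s).
  move=> [[U V] [/= /nbhsIP[d d0 dU] xV] UV].
  near=> t.
  have ts : `|set_val t - set_val s| < d.
    near: t; apply: nbhs_dnbhs; apply/nbhsIP.
    by exists d.
  have xt : V (x t) by near: t; apply: nbhs_dnbhs; exact: (cx _ xV).
  have [c cs ->] := MVT_unitI_near s t (d1 (x t)).
  have ne : set_val t - set_val s != 0 :> R.
    rewrite subr_eq0; have : t != s by near: t; exact: nbhs_dnbhs_neq.
    by apply: contra => /eqP /val_inj ->.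
  rewrite mulfK//; apply: (UV (c, x t)); split => //=.
  by apply: dU; exact: le_lt_trans cs ts.
rewrite (_ : diffquotI _ _ = fun t =>
    (g (t, x t) - g (s, x t)) / (set_val t - set_val s) +
    q (x t) * diffquotI x s t); last first.
  by apply/funext => t; rewrite /diffquotI mulrA -qE /u; ring.
apply: cvgD => //; apply: cvgM; last exact: derivableI_cvg.
apply: cvg_within_filter.
rewrite (_ : partial2 g _ = q (x s)); last by rewrite /q eqxx.
exact: (continuous_comp cx q_cvg).
Unshelve. all: by end_near. Qed.

Fixpoint CkI n x := if n is n'.+1 then derivableI x /\ CkI n' (derivI x)
                    else True.

Lemma smoothI_CkI x : smoothI x <-> forall n, CkI n x.
Proof.
split=> [sx n|].
  elim: n x sx => //= n IH x sx; split; first exact: (sx 0%N).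
  by apply: IH => k; have := sx k.+1; rewrite iterSr.
move=> h n; elim: n x h => [|n IH] x h; first exact: (h 1%N).1.
by rewrite iterSr; apply: IH => k; exact: (h k.+1).2.
Qed.

Lemma CkIS n x : CkI n.+1 x -> CkI n x.
Proof. by elim: n x => //= n IH x [dx /IH]. Qed.

Lemma CkID n x y : CkI n x -> CkI n y -> CkI n (fun t => x t + y t).
Proof.
elim: n x y => //= n IH x y [dx nx] [dy ny].
have h s : diffquotI (fun t => x t + y t) s @ s^' --> derivI x s + derivI y s.
  rewrite (_ : (fun t => x t + y t) = (fun t => 1 * x t + y t)); last first.
    by apply/funext => t; rewrite mul1r.
  by rewrite -[derivI x s]mul1r; apply: cvgI_lin; exact: derivableI_cvg.
split; first by move=> s; apply/cvg_ex; eexists; exact: h.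
rewrite (_ : derivI _ = fun s => derivI x s + derivI y s); first exact: IH.
by apply/funext => s; exact: derivI_cvg.
Qed.

Lemma CkIM n x y : CkI n x -> CkI n y -> CkI n (fun t => x t * y t).
Proof.
elim: n x y => // n IH x y xn yn.
have [dx nx] := xn; have [dy ny] := yn.
have h s : diffquotI (fun t => x t * y t) s @ s^' -->
    derivI x s * y s + x s * derivI y s.
  by apply: cvgI_mul => //; exact: derivableI_cvg.
split; first by move=> s; apply/cvg_ex; eexists; exact: h.
rewrite (_ : derivI _ = fun s => derivI x s * y s + x s * derivI y s).
  by apply: CkID; apply: IH => //; exact: CkIS.
by apply/funext => s; exact: derivI_cvg.
Qed.

Lemma smooth2_comp g x : smooth2 g -> smoothI x ->
  smoothI (fun s => g (s, x s)).
Proof.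
move=> sg sx; have dx : derivableI x := sx 0%N.
have sx1 : forall n, CkI n (derivI x).
  by move=> n; have /smoothI_CkI/(_ n.+1)[] := sx.
apply/smoothI_CkI => n; elim: n g sg => // n IH g sg.
have [cg1 _ _] := sg [:: true].
have h s := @chain_rule x g s (sg [::]) cg1 dx.
split; first by move=> s; apply/cvg_ex; eexists; exact: h.
rewrite (_ : derivI _ = fun s =>
    partial1 g (s, x s) + partial2 g (s, x s) * derivI x s).
  apply: CkID; first by apply: IH; exact: smooth2_partial1.
  by apply: CkIM => //; apply: IH; exact: smooth2_partial2.
by apply/funext => s; exact: derivI_cvg.
Qed.

Lemma superposition_subproof (phi : unitI R * R -> R) (x : smoothfun R) :
  smooth2 phi ->
  ((fun s => phi (s, x s)) : unitI R -> R^o) \in @smoothIb R.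
Proof.
by move=> sphi; apply/asboolP; apply: smooth2_comp => //; exact: smoothfunP.
Qed.

Definition superposition (phi : unitI R * R -> R) (sphi : smooth2 phi)
  (x : smoothfun R) : smoothfun R := SmoothFun (superposition_subproof x sphi).

Lemma superpositionE (phi : unitI R * R -> R) (sphi : smooth2 phi)
  (x : smoothfun R) (s : unitI R) : superposition sphi x s = phi (s, x s).
Proof. by []. Qed.

End smooth_two_variables.

(* [tvsType R] provides a locally convex topological vector space; separation
   is a separate hypothesis, [hausdorff_space]. *)
Section locally_convex_spaces.
Variables (R : realType) (E : tvsType R).
Implicit Types (A B D U V S : set E) (x y u v : E) (f : E -> E) (a b r t : R).

Definition scaled t A : set E := [set t *: v | v in A].

Definition absolutely_convex A :=
  forall u v a b, A u -> A v -> `|a| + `|b| <= 1 -> A (a *: u + b *: v).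

Definition absorbs U A :=
  exists2 r, 0 < r & forall t, r <= `|t| -> A `<=` scaled t U.

Definition vn_bounded A := forall U, nbhs (0 : E) U -> absorbs U A.

Definition bornological := forall U, absolutely_convex U ->
  (forall A, vn_bounded A -> absorbs U A) -> nbhs (0 : E) U.

(* The linear span of B when B is nonempty and absolutely convex. *)
Definition cone_span B : set E :=
  [set u | exists t, 0 < t /\ exists2 v, B v & u = t *: v].

Definition minkowski B u : R :=
  inf [set t | 0 < t /\ scaled t B u].

Definition linear_subspace S :=
  S 0 /\ forall a u v, S u -> S v -> S (a *: u + v).

Definition norm_on S (N : E -> R) :=
  [/\ forall u, S u -> N u = 0 -> u = 0,
      forall a u, S u -> N (a *: u) = `|a| * N u &
      forall u v, S u -> S v -> N (u + v) <= N u + N v].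

Definition complete_on S (N : E -> R) :=
  forall s : nat -> E, (forall n, S (s n)) ->
    (forall e : R, 0 < e -> exists k : nat, forall m n,
      (k <= m)%N -> (k <= n)%N -> N (s m - s n) < e) ->
    exists2 u, S u & forall e : R, 0 < e -> exists k : nat, forall n,
      (k <= n)%N -> N (s n - u) < e.

Definition banach_on S (N : E -> R) :=
  [/\ linear_subspace S, norm_on S N & complete_on S N].

Definition locally_complete := forall B, B !=set0 -> closed B ->
  absolutely_convex B -> vn_bounded B -> banach_on (cone_span B) (minkowski B).

Definition bornological_generator (BB : set (set E)) :=
  [/\ forall B, BB B ->
        [/\ B !=set0, vn_bounded B, closed B & absolutely_convex B],
      forall A B, BB A -> BB B -> exists2 C, BB C & A `|` B `<=` C &
      forall A, vn_bounded A -> exists t, 0 < t /\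
        exists2 B, BB B & A `<=` scaled t B].

Definition gateaux_quotient f x v : R -> E :=
  fun t => t^-1 *: (f (x + t *: v) - f x).

(* f'(x)v; the default value 0 is returned when the limit does not exist. *)
Definition gderiv f x v : E :=
  xget 0 [set l | gateaux_quotient f x v t @[t --> (0 : R)^'] --> l].

(* A partial map dom f -> E is given by its domain D and a total function f
   whose values outside D are irrelevant: D contains x + tv for small t. *)
Definition gateaux_differentiable D f := forall x, D x ->
  [/\ forall v, \forall t \near (0 : R), D (x + t *: v),
      forall v, exists l : E, gateaux_quotient f x v t @[t --> (0 : R)^'] --> l,
      linear (gderiv f x) &
      continuous (gderiv f x)].

Definition linear_homeomorphism (L : E -> E) :=
  [/\ linear L, continuous L &
      exists L' : E -> E, [/\ cancel L L', cancel L' L & continuous L']].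

Record ColoA D f (y0 : E) (eps : R) (BB : set (set E)) : Prop := {
  ColoA_hausdorff : hausdorff_space E ;
  ColoA_bornological : bornological ;
  ColoA_locally_complete : locally_complete ;
  ColoA_gateaux : gateaux_differentiable D f ;
  ColoA_eps_gt0 : 0 < eps ;
  ColoA_generator : bornological_generator BB ;
  ColoA_estimate : forall B, BB B -> forall v, B v ->
    let y1 := y0 + 2 *: v in
    [/\ D y1, cone_span B y1 &
        [set gderiv f y1 w - gderiv f y0 w | w in B] `<=`
          scaled eps (gderiv f y0 @` B)] }.

Definition Colo0 D f y0 eps BB :=
  ColoA D f y0 eps BB /\ linear_homeomorphism (gderiv f y0).

Definition Colombeau0_tame D f y0 := forall V, open V -> V y0 ->
  exists BB : set (set E), Colo0 (V `&` D) f y0 (1 / 2) BB.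

End locally_convex_spaces.

(* Main.v *)
Require Import Defs.
From HB Require Import structures.
From mathcomp Require Import all_boot all_order all_algebra.
From mathcomp Require Import all_classical all_reals all_analysis.
From mathcomp Require Import ring lra.
Import Order.TTheory GRing.Theory Num.Theory.
Import numFieldNormedType.Exports.
Local Open Scope classical_set_scope.
Local Open Scope ring_scope.

(** Write [A y] for the smooth function [s |-> partial2 phi (s, y s)] and
[|v|_i] for the [i]-th seminorm. The derivative of the superposition operator
at [y] is multiplication by [A y]
([gateaux_quotient_superposition]); since [A x] vanishes nowhere, [1 / A x] is
smooth, so the derivative at [x] is a linear homeomorphism, and the required
inclusion says that multiplication by
[g v = (A (x + 2 v) - A x) / A x] maps the bounded set [B] into [B / 2] for
every [v] in [B].

The sets [B] are the boxes [box c = {v | |v|_i <= c i for all i}], with bounds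
chosen so that this contraction holds. Let [V] contain the ball of radius [e]
of [x] for the seminorms of order at most [n]. Up to order [n] all the bounds
equal one small number [d], so that [x + 2 v] stays in [V]; since [g] vanishes
at [0] and is locally Lipschitz for the norm of every fixed order
([relative_increment_small]), the product [g v * w] is of size [d ^ 2] there, at
most [d / 2]. Above order [n] the bounds are chosen one after the other, each
of them large in terms of the previous ones. This works because the top
derivative enters the chain and Leibniz rules linearly: [|g v|_i] is at most
[L |v|_i + K], where [L] does not depend on [i], and [K] depends only on the
seminorms of [v] of lower order ([relative_increment_top]). Hence
[|g v * w|_i <= (C + L) d (c i) + K'] with [K'] depending on the lower
bounds only, and this is at most [c i / 2] if [d] was small and [c i] is large
([contraction_threshold]).

As the bounds above order [n] may be increased at will, these boxes are
directed and absorb every bounded set ([contracting_boxes_generator]).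

The rest is the general theory of the space: it is complete, because uniform
convergence of functions and of their derivatives passes to the limit
([unif_cvg_derivI]), hence locally complete; it is metrizable, hence
bornological. The product and chain rules are used on whole functions rather
than pointwise, so that the estimates are inductions on the order of the
seminorm, reducing [|y|_(k+1)] to [|y'|_k]. *)

Set Implicit Arguments.
Unset Strict Implicit.
Unset Printing Implicit Defensive.

(** * Uniform limits of functions and of their derivatives *)

Section uniform_limits.
Variable R : realType.
Implicit Types (x y : unitI R -> R) (s t : unitI R) (u : nat -> unitI R -> R).

Definition unif_cvg u x := forall e : R, 0 < e ->
  exists N, forall n, (N <= n)%N -> forall s, `|u n s - x s| < e.

Lemma derivI_lin (a : R) x y s : derivableI x -> derivableI y ->
  derivI (fun t => a * x t + y t) s = a * derivI x s + derivI y s.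
Proof.
by move=> dx dy; apply: derivI_cvg; apply: cvgI_lin; exact: derivableI_cvg.
Qed.

Lemma derivableI_lin (a : R) x y : derivableI x -> derivableI y ->
  derivableI (fun t => a * x t + y t).
Proof.
move=> dx dy s; apply/cvg_ex; eexists.
by apply: cvgI_lin; exact: derivableI_cvg.
Qed.

(** By the mean value theorem the difference quotients of [u n] at [s] converge
uniformly, so the limits [n -> oo] and [t -> s] can be exchanged. *)
Lemma unif_cvg_derivI u x y : (forall n, derivableI (u n)) ->
  unif_cvg u x -> unif_cvg (fun n => derivI (u n)) y ->
  forall s, diffquotI x s @ s^' --> y s.
Proof.
move=> du ux uy s; apply/cvgrPdist_lt => e e0.
have d0 : 0 < e / 4 by lra.
have [N Ny] := uy _ d0.
(* The limit of the estimate for [u m] as [m] grows, whence the slack [h]. *)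
have close t : `|(u N t - u N s) - (x t - x s)|
    <= e / 2 * `|set_val t - set_val s|.
  apply/ler_addgt0Pr => h h0.
  have [|M Mx] := ux (h / 2); first by lra.
  pose m := maxn N M.
  have {Mx} mx := Mx m (leq_maxr _ _).
  have [c _ cE] := @MVT_unitI_near R (fun r => -1 * u m r + u N r) s t
    (derivableI_lin (du m) (du N)).
  have : `|(-1 * u m t + u N t) - (-1 * u m s + u N s)|
      <= e / 2 * `|set_val t - set_val s|.
    rewrite cE normrM ler_wpM2r// derivI_lin//.
    have := Ny m (leq_maxl _ _) c; have := Ny N (leqnn _) c.
    rewrite !ltr_norml ler_norml => /andP[? ?] /andP[? ?].
    by apply/andP; split; lra.
  have := mx t; have := mx s.
  set a := e / 2 * _; rewrite !ltr_norml !ler_norml.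
  by move=> /andP[? ?] /andP[? ?] /andP[? ?]; apply/andP; split; lra.
have /cvgrPdist_lt/(_ _ d0) Ns := @derivableI_cvg R (u N) s (du N).
near=> t.
have ts : 0 < `|set_val t - set_val s|.
  rewrite normr_gt0 subr_eq0; have : t != s by near: t; exact: nbhs_dnbhs_neq.
  by apply: contra => /eqP /val_inj ->.
have h1 : `|derivI (u N) s - diffquotI (u N) s t| < e / 4 by near: t; exact: Ns.
have h2 := Ny N (leqnn _) s.
have h3 : `|diffquotI (u N) s t - diffquotI x s t| <= e / 2.
  by rewrite /diffquotI -mulrBl normrM normfV ler_pdivrMr.
move: h1 h2 h3; rewrite !ltr_norml !ler_norml.
by move=> /andP[? ?] /andP[? ?] /andP[? ?]; apply/andP; split; lra.
Unshelve. all: by end_near. Qed.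

Lemma cauchy_unif_cvg u :
  (forall e : R, 0 < e -> exists N, forall m n, (N <= m)%N -> (N <= n)%N ->
    forall s, `|u m s - u n s| < e) ->
  exists x, unif_cvg u x.
Proof.
move=> uc.
have cu s : cvg (u ^~ s @ \oo).
  apply: cauchy_cvg; apply/cauchy_exP => e e0.
  have [N Nu] := uc e e0.
  exists (u N s); exists N => // n /= Nn.
  exact: Nu.
exists (fun s => lim (u ^~ s @ \oo)) => e e0.
have [|N Nu] := uc (e / 2); first lra.
exists N => n Nn s.
suff : `|u n s - lim (u ^~ s @ \oo)| <= e / 2 by lra.
apply/ler_addgt0Pr => h h0.
have /cvgrPdist_lt/(_ h h0) [M _ Mu] := cu s.
have := Mu (maxn N M) (leq_maxr _ _).
have := Nu n (maxn N M) Nn (leq_maxl _ _) s.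
rewrite !ltr_norml ler_norml => /andP[? ?] /andP[? ?].
by apply/andP; split; lra.
Qed.

End uniform_limits.

(** * The space of smooth functions *)

Section frechet_space.
Variable R : realType.
Notation E := (smoothfun R).
Implicit Types (x y z u v w : E).

Lemma seminormB_sym k x y : seminorm k (x - y) = seminorm k (y - x).
Proof. by rewrite -seminormN opprB. Qed.

Lemma seminormB k x y z :
  seminorm k (x - z) <= seminorm k (x - y) + seminorm k (y - z).
Proof.
by rewrite (_ : x - z = (x - y) + (y - z)) ?seminormD// addrA subrK.
Qed.

Lemma seminormZE k (a : R) x : seminorm k (a *: x) = `|a| * seminorm k x.
Proof.
apply/eqP; rewrite eq_le seminormZ /=.
have [->|a0] := eqVneq a 0; first by rewrite normr0 mul0r seminorm_ge0.
have := seminormZ k a^-1 (a *: x).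
by rewrite scalerA mulVf// scale1r normfV ler_pdivlMl// normr_gt0.
Qed.

Lemma DnB k x y s : Dn k (x - y) s = Dn k x s - Dn k y s.
Proof. by rewrite addrC -scaleN1r DnE mulN1r addrC. Qed.

Lemma seminorm0_eq0 x : seminorm 0 x = 0 -> x = 0.
Proof.
move=> x0; apply: val_inj; apply/funext => s; apply/eqP.
rewrite -normr_le0 -x0; exact: (Dn_le_seminorm 0 x s).
Qed.

(** Only a finite number of seminorms enters a neighborhood, so convergence can
be checked one seminorm at a time. *)
Lemma cvg_seminormP (T : Type) (F : set_system T) (f : T -> E) x : Filter F ->
  f @ F --> x <-> forall k (e : R), 0 < e ->
    \forall t \near F, seminorm k (f t - x) < e.
Proof.
move=> FF; split=> [fx k e e0|fx U [n [e e0 eU]]].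
  have h := fx _ (nbhs_seminorm_ball x k e0).
  by apply: (@filterS _ F FF _ _ _ h) => t /(_ k (leqnn k)).
have : \forall t \near F, forall i, (i <= n)%N -> seminorm i (f t - x) < e.
  elim: n {eU} => [|n IH].
    by apply: filterS _ (fx 0%N e e0) => t t0 i; rewrite leqn0 => /eqP ->.
  apply: filterS2 _ IH (fx n.+1 e e0) => t IH tn i.
  by rewrite leq_eqVlt ltnS => /orP[/eqP ->//|/IH].
by apply: filterS => t tx; exact: eU.
Qed.

Lemma smoothfun_complete (u : nat -> E) :
  (forall k (e : R), 0 < e -> exists N, forall m n, (N <= m)%N -> (N <= n)%N ->
    seminorm k (u m - u n) < e) ->
  exists x, u @ \oo --> x.
Proof.
move=> uc.
have /choice[y uy] k :
    exists y : unitI R -> R, unif_cvg (fun n => Dn k (u n)) y.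
  apply: cauchy_unif_cvg => e e0; have [N Nu] := uc k e e0.
  exists N => m n Nm Nn s; rewrite -DnB.
  by apply: le_lt_trans (Dn_le_seminorm _ _ _) _; exact: Nu.
have dy k s : diffquotI (y k) s @ s^' --> y k.+1 s.
  apply: (@unif_cvg_derivI R (fun n => Dn k (u n))); last 2 first.
  - exact: uy.
  - exact: (uy k.+1).
  - by move=> n; exact: (@smoothfunP R (u n) k).
have yE k : iter k (@derivI R) (y 0%N) = y k.
  elim: k => //= k ->; apply/funext => s; exact: derivI_cvg.
have sy : (y 0%N : unitI R -> R^o) \in @smoothIb R.
  apply/asboolP => k; rewrite yE => s; apply/cvg_ex; exists (y k.+1 s); exact: dy.
exists (SmoothFun sy); apply/cvg_seminormP => k e e0.
have [|N Nu] := uy k (e / 2); first lra.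
exists N => // n /= Nn; apply: (@le_lt_trans _ _ (e / 2)); last by lra.
apply: seminorm_le => s; rewrite DnB.
have -> : Dn k (SmoothFun sy) s = y k s by rewrite /Dn /= yE.
exact/ltW/Nu.
Qed.

Lemma smoothfun_hausdorff : hausdorff_space E.
Proof.
move=> x y xy; apply/eqP; rewrite -subr_eq0; apply/eqP/seminorm0_eq0.
apply/eqP; rewrite eq_le seminorm_ge0 andbT; apply/ler_addgt0Pr => e e0.
have e2 : 0 < e / 2 by lra.
have [z [xz yz]] := xy _ _ (nbhs_seminorm_ball x 0 e2)
  (nbhs_seminorm_ball y 0 e2).
have := seminormB 0 x z y; rewrite (seminormB_sym 0 x z).
by have := xz 0%N isT; have := yz 0%N isT; lra.
Qed.

Lemma finite_majorant (m : nat -> R) n :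
  exists2 M, 0 < M & forall i, (i <= n)%N -> m i <= M.
Proof.
exists (1 + \sum_(i < n.+1) `|m i|).
  by rewrite ltr_pwDl// sumr_ge0.
move=> i im; rewrite (bigD1 (Ordinal (im : (i < n.+1)%N)))//=.
have := ler_norm (m i); set s := \sum_(_ | _) _.
have : 0 <= s by rewrite sumr_ge0.
by lra.
Qed.

Lemma vn_boundedP (A : set E) : vn_bounded A <->
  exists m : nat -> R, forall i x, A x -> seminorm i x <= m i.
Proof.
split=> [Ab|[m mA] U [n [e e0 eU]]].
  have /choice[m mP] i : exists m, forall x, A x -> seminorm i x <= m;
    last by exists m.
  have [r r0 rA] := Ab _ (nbhs_seminorm_ball 0 i (@ltr01 R)).
  exists r => x Ax; have [|y /(_ i (leqnn i)) y1 <-] := rA r _ x Ax.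
    by rewrite gtr0_norm.
  rewrite seminormZE gtr0_norm//; rewrite subr0 in y1.
  by rewrite ler_piMr// ltW.
have [M M0 mM] := finite_majorant m n.
exists (M / e + 1); first by rewrite addr_gt0// divr_gt0.
move=> t tM x Ax.
have t0 : 0 < `|t| by apply: lt_le_trans tM; rewrite addr_gt0// divr_gt0.
exists (t^-1 *: x); last by rewrite scalerA divff ?scale1r// -normr_gt0.
apply: eU => i im; rewrite subr0 seminormZE normfV.
rewrite ltr_pdivrMl//; apply: (@le_lt_trans _ _ M).
  by apply: le_trans (mM i im); exact: mA.
by rewrite -ltr_pdivrMr//; lra.
Qed.

(** The usual argument for metrizable spaces. If an absolutely convex set [U] is
not a neighborhood of [0], some [u n] outside [U] has its seminorms of order
at most [n] below [1 / (n + 1) ^ 2]; then the sequence [(n + 1) u n] is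
bounded and cannot be absorbed by [U]. *)
Lemma smoothfun_bornological : bornological E.
Proof.
move=> U Uc Ub; apply: contrapT => nU.
have /choice[u uP] n : exists u, seminorm_ball 0 n (n.+1%:R ^- 2) u /\ ~ U u.
  apply: contrapT => h; apply: nU; exists n, (n.+1%:R ^- 2).
    by rewrite invr_gt0 exprn_gt0.
  by move=> u hu; apply: contrapT => Uu; apply: h; exists u.
have [|r r0 rU] := Ub (range (fun n => n.+1%:R *: u n)).
  apply/vn_boundedP.
  have /choice[m mP] i : exists m, forall n, (n <= i)%N ->
      seminorm i (n.+1%:R *: u n) <= m.
    have [M M0 Mm] := finite_majorant (fun n => seminorm i (n.+1%:R *: u n)) i.
    by exists M.
  exists (fun i => Num.max 1 (m i)) => i _ [n _ <-].
  have [ni|/ltnW ni] := leqP n i; first by rewrite le_max mP ?orbT.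
  rewrite le_max; apply/orP; left.
  have [/(_ i ni) + _] := uP n; rewrite subr0 => h.
  rewrite seminormZE ger0_norm//.
  apply: le_trans (ler_wpM2l _ (ltW h)) _ => //.
  by rewrite expr2 invfM mulrA divff// mul1r invf_le1// ler1n.
pose n := Num.truncn r.
have rn : r <= `|n.+1%:R|.
  by rewrite ger0_norm// ltW// truncnS_gt.
have [|v Uv] := rU _ rn (n.+1%:R *: u n); first by exists n.
have [_ nUn] := uP n.
move=> /(congr1 (fun z => n.+1%:R^-1 *: z)).
by rewrite !scalerA mulVf// !scale1r => vu; apply: nUn; rewrite -vu.
Qed.

End frechet_space.

(** * Minkowski functionals and local completeness *)

Section minkowski_functional.
Variables (R : realType) (E : tvsType R) (B : set E).
Hypotheses (B_ex : B !=set0) (B_ac : absolutely_convex B).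
Implicit Types (u v : E) (a t : R).

(** Convexity of [B] in the form that gives at once that its span is a subspace,
that dilates of [B] increase, and that the Minkowski functional is
subadditive. *)
Lemma scaled_lin a t t' u v : 0 < t -> 0 < t' ->
  scaled t B u -> scaled t' B v -> scaled (`|a| * t + t') B (a *: u + v).
Proof.
move=> t0 t'0 [u' Bu <-] [v' Bv <-].
set r := _ + t'; have r0 : 0 < r by rewrite ltr_wpDl// mulr_ge0// ltW.
exists ((a * t / r) *: u' + (t' / r) *: v'); last first.
  by rewrite scalerDr !scalerA ![r * _]mulrC !divfK ?gt_eqF.
apply: B_ac => //.
rewrite !normrM normfV (gtr0_norm t0) (gtr0_norm t'0) (gtr0_norm r0) -mulrDl.
by rewrite divff// gt_eqF.
Qed.

Lemma scaled0 t : scaled t B 0.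
Proof.
have [u Bu] := B_ex; exists 0; last by rewrite scaler0.
rewrite (_ : 0 = 0 *: u + 0 *: u); last by rewrite !scale0r addr0.
by apply: B_ac => //; rewrite normr0 addr0.
Qed.

Lemma scaled_le t t' u : 0 < t -> t <= t' -> scaled t B u -> scaled t' B u.
Proof.
move=> t0; rewrite le_eqVlt => /predU1P[->//|tt' tu].
have tt0 : 0 < t' - t by rewrite subr_gt0.
have := scaled_lin 1 t0 tt0 tu (scaled0 _).
by rewrite scale1r addr0 normr1 mul1r subrKC.
Qed.

Lemma scaledZ a t u : a != 0 -> 0 < t -> scaled t B u ->
  scaled (`|a| * t) B (a *: u).
Proof.
move=> a0 t0 [v Bv <-].
exists ((a / `|a|) *: v); last first.
  by rewrite !scalerA; congr (_ *: _); field; rewrite normr_eq0.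
rewrite -[_ *: v]addr0 -[X in _ + X](scale0r v); apply: B_ac => //.
by rewrite normr0 addr0 normrM normfV normr_id divff// normr_eq0.
Qed.

Lemma cone_spanE u : cone_span B u <-> exists2 t, 0 < t & scaled t B u.
Proof.
split=> [[t [t0 [v Bv ->]]]|[t t0 [v Bv <-]]].
  by exists t => //; exists v.
by exists t; split => //; exists v.
Qed.

Lemma cone_span_subspace : linear_subspace (cone_span B).
Proof.
split; first by apply/cone_spanE; exists 1 => //; exact: scaled0.
move=> a u v /cone_spanE[t t0 tu] /cone_spanE[t' t'0 tv]; apply/cone_spanE.
by exists (`|a| * t + t'); [rewrite ltr_wpDl// mulr_ge0// ltW|exact: scaled_lin].
Qed.

Lemma cone_spanB u v : cone_span B u -> cone_span B v -> cone_span B (u - v).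
Proof.
move=> su sv; have [_ lin] := cone_span_subspace.
by rewrite addrC -scaleN1r; exact: lin.
Qed.

Lemma minkowski_le t u : 0 < t -> scaled t B u -> Defs.minkowski B u <= t.
Proof. by move=> t0 tu; apply: ge_inf => //; exists 0 => r [/ltW]. Qed.

Lemma minkowski_ge0 u : 0 <= Defs.minkowski B u.
Proof.
rewrite /Defs.minkowski; set A := [set _ | _].
have [->|/set0P A0] := eqVneq A set0; first by rewrite inf0.
by apply: lb_le_inf => // r [/ltW].
Qed.

Lemma scaled_minkowski t u :
  cone_span B u -> Defs.minkowski B u < t -> scaled t B u.
Proof.
move=> /cone_spanE[r r0 ru] ut.
have [|s [s0 su] st] := @inf_lt _ _ _ _ ut; first by exists r.
exact: scaled_le (ltW st) su.
Qed.

Lemma minkowskiZ_le a u : cone_span B u ->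
  Defs.minkowski B (a *: u) <= `|a| * Defs.minkowski B u.
Proof.
move=> su; have [->|a0] := eqVneq a 0.
  rewrite scale0r normr0 mul0r; apply/ler_addgt0Pr => e e0.
  by rewrite add0r; apply: minkowski_le => //; exact: scaled0.
rewrite -ler_pdivrMl ?normr_gt0//; apply/ler_addgt0Pr => e e0.
rewrite ler_pdivrMl ?normr_gt0//.
have te : 0 < Defs.minkowski B u + e by rewrite ltr_wpDl// minkowski_ge0.
apply: minkowski_le; first by rewrite mulr_gt0// normr_gt0.
by apply: scaledZ => //; apply: scaled_minkowski => //; rewrite ltrDl.
Qed.

Lemma minkowskiZ a u : cone_span B u ->
  Defs.minkowski B (a *: u) = `|a| * Defs.minkowski B u.
Proof.
move=> su; apply/eqP; rewrite eq_le minkowskiZ_le//=.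
have [->|a0] := eqVneq a 0; first by rewrite normr0 mul0r minkowski_ge0.
have sau : cone_span B (a *: u).
  have [s0 lin] := cone_span_subspace.
  by rewrite -[_ *: _]addr0; exact: lin.
have := minkowskiZ_le a^-1 sau.
by rewrite scalerA mulVf// scale1r normfV ler_pdivlMl// normr_gt0.
Qed.

Lemma minkowskiD u v : cone_span B u -> cone_span B v ->
  Defs.minkowski B (u + v) <= Defs.minkowski B u + Defs.minkowski B v.
Proof.
move=> su sv; apply/ler_addgt0Pr => e e0.
have hu : 0 < Defs.minkowski B u + e / 2 by have := minkowski_ge0 u; lra.
have hv : 0 < Defs.minkowski B v + e / 2 by have := minkowski_ge0 v; lra.
have := @scaled_lin 1 _ _ u v hu hv.
rewrite scale1r normr1 mul1r => h.
rewrite (_ : _ + e =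
  Defs.minkowski B u + e / 2 + (Defs.minkowski B v + e / 2)); last lra.
apply: minkowski_le; first lra.
by apply: h; apply: scaled_minkowski => //; lra.
Qed.

End minkowski_functional.

Section local_completeness.
Variable R : realType.
Notation E := (smoothfun R).

Lemma scaled_seminorm (B : set E) (m : nat -> R) k (t : R) (u : E) : 0 < t ->
  (forall i x, B x -> seminorm i x <= m i) -> scaled t B u ->
  seminorm k u <= t * m k.
Proof.
move=> t0 Bm [v Bv <-].
by rewrite seminormZE gtr0_norm// ler_wpM2l ?Bm// ltW.
Qed.

(** A Cauchy sequence for the Minkowski functional of [B] is Cauchy for each
seminorm, as [B] is bounded, so it converges in the space. Closedness of [B]
turns [s i - s j] in [e B] into [s i - u] in [e B]. *)
Lemma smoothfun_locally_complete : locally_complete E.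
Proof.
move=> B B0 Bcl Bac /vn_boundedP[m Bm].
split; first exact: cone_span_subspace.
  split=> [u su u0|a u su|u v su sv]; last 2 first.
  - exact: minkowskiZ.
  - exact: minkowskiD.
  apply: seminorm0_eq0; apply/eqP; rewrite eq_le seminorm_ge0 andbT.
  apply/ler_addgt0Pr => e e0; rewrite add0r.
  have m0 : 0 <= m 0%N.
    have [v Bv] := B0; apply: le_trans (Bm 0%N v Bv); exact: seminorm_ge0.
  have h : 0 < e / (m 0%N + 1) by rewrite divr_gt0//; lra.
  have us : scaled (e / (m 0%N + 1)) B u by apply: scaled_minkowski; rewrite ?u0.
  apply: le_trans (scaled_seminorm 0 h Bm us) _.
  rewrite mulrAC ler_pdivrMr; last by lra.
  by rewrite ler_pM2l//; lra.
move=> s ss sc.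
have dist (e : R) : 0 < e -> exists N, forall i j, (N <= i)%N -> (N <= j)%N ->
    scaled e B (s i - s j).
  move=> e0; have [N Ns] := sc e e0; exists N => i j Ni Nj.
  by apply: scaled_minkowski => //; [exact: cone_spanB|exact: Ns].
have [|u su] := @smoothfun_complete R s.
  move=> k e e0.
  have h : 0 < e / (`|m k| + 1) by rewrite divr_gt0// ltr_wpDl.
  have [N Ns] := dist _ h; exists N => i j Ni Nj.
  apply: le_lt_trans (scaled_seminorm k h Bm (Ns i j Ni Nj)) _.
  rewrite mulrAC ltr_pdivrMr ?ltr_wpDl// ltr_pM2l//.
  by have := ler_norm (m k); lra.
have lim (e : R) : 0 < e -> exists N, forall i, (N <= i)%N ->
    scaled e B (s i - u).
  move=> e0; have [N Ns] := dist e e0; exists N => i Ni.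
  exists (e^-1 *: (s i - u)); last by rewrite scalerA divff ?scale1r// gt_eqF.
  apply: Bcl => U [k [r r0 rU]].
  have re : 0 < r * e by rewrite mulr_gt0.
  have [M _ Ms] := su _ (nbhs_seminorm_ball u k re).
  pose j := maxn N M.
  exists (e^-1 *: (s i - s j)); split.
    have [v Bv <-] := Ns i j Ni (leq_maxl _ _).
    by rewrite scalerA mulVf ?scale1r// gt_eqF.
  apply: rU => l lk.
  rewrite -scalerBr opprB addrC addrA subrK.
  rewrite seminormZE normfV gtr0_norm// ltr_pdivrMl// mulrC seminormB_sym.
  by apply: Ms lk => /=; exact: leq_maxr.
exists u.
  have [N Ns] := lim 1 ltr01; rewrite -(subKr (s N) u).
  apply: cone_spanB => //; apply/cone_spanE; exists 1 => //; exact: Ns.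
move=> e e0; have [|N Ns] := lim (e / 2); first lra.
exists N => i Ni; apply: (@le_lt_trans _ _ (e / 2)); last lra.
by apply: minkowski_le; [lra|exact: Ns].
Qed.

End local_completeness.

(** * Pointwise product and differentiation of smooth functions *)

Section product.
Variable R : realType.
Notation E := (smoothfun R).
Implicit Types (x y z : E) (a b : R) (s t : unitI R).

Lemma smoothfunDE x y s : (x + y) s = x s + y s. Proof. by []. Qed.
Lemma smoothfunBE x y s : (x - y) s = x s - y s. Proof. by []. Qed.
Lemma smoothfunZE a x s : (a *: x) s = a * x s. Proof. by []. Qed.

Lemma smoothfun_eq x y : (forall s, x s = y s) -> x = y.
Proof. by move=> xy; apply: val_inj; apply/funext. Qed.

Lemma smul_subproof x y : (fun s => x s * y s : R^o) \in @smoothIb R.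
Proof.
apply/asboolP/smoothI_CkI => n.
by apply: CkIM; move: n; apply/smoothI_CkI; exact: smoothfunP.
Qed.

Definition smul x y : E := SmoothFun (smul_subproof x y).
Local Notation "x ** y" := (smul x y) (at level 40, left associativity).

Lemma smulE x y s : (x ** y) s = x s * y s. Proof. by []. Qed.

Lemma smulC x y : x ** y = y ** x.
Proof. by apply: smoothfun_eq => s; rewrite !smulE mulrC. Qed.

Lemma smulA x y z : x ** (y ** z) = x ** y ** z.
Proof. by apply: smoothfun_eq => s; rewrite !smulE mulrA. Qed.

Lemma smul_linr a x y z : x ** (a *: y + z) = a *: (x ** y) + x ** z.
Proof.
by apply: smoothfun_eq => s; rewrite !(smulE, smoothfunDE, smoothfunZE); ring.
Qed.

Lemma smulBr x y z : x ** (y - z) = x ** y - x ** z.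
Proof.
by apply: smoothfun_eq => s; rewrite !(smulE, smoothfunBE); ring.
Qed.

Lemma smulBl x y z : (x - y) ** z = x ** z - y ** z.
Proof. by rewrite smulC smulBr !(smulC z). Qed.

Lemma sderiv_subproof x : (derivI x : unitI R -> R^o) \in @smoothIb R.
Proof.
apply/asboolP => n; have := @smoothfunP R x n.+1; rewrite iterSr; exact.
Qed.

Definition sderiv x : E := SmoothFun (sderiv_subproof x).

Lemma seminorm_sderiv k x : seminorm k (sderiv x) = seminorm k.+1 x.
Proof. by rewrite /seminorm /Dn iterSr. Qed.

Lemma sderiv_lin a x y : sderiv (a *: x + y) = a *: sderiv x + sderiv y.
Proof.
by apply: smoothfun_eq => s; apply: derivI_lin; exact: (@smoothfunP R _ 0%N).
Qed.

Lemma sderivD x y : sderiv (x + y) = sderiv x + sderiv y.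
Proof. by have := sderiv_lin 1 x y; rewrite !scale1r. Qed.

Lemma sderivB x y : sderiv (x - y) = sderiv x - sderiv y.
Proof. by rewrite addrC -scaleN1r sderiv_lin scaleN1r addrC. Qed.

Lemma sderivZ a x : sderiv (a *: x) = a *: sderiv x.
Proof.
have d0 : sderiv (0 : E) = 0 by rewrite -[X in sderiv X](subrr 0) sderivB subrr.
by have := sderiv_lin a x 0; rewrite d0 !addr0.
Qed.

Lemma sderiv_smul x y : sderiv (x ** y) = sderiv x ** y + x ** sderiv y.
Proof.
apply: smoothfun_eq => s; apply: derivI_cvg.
have dx := @smoothfunP R x 0%N; have dy := @smoothfunP R y 0%N.
by apply: cvgI_mul => //; exact: derivableI_cvg.
Qed.

Lemma smul_seminorm0 x y : seminorm 0 (x ** y) <= seminorm 0 x * seminorm 0 y.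
Proof.
apply: seminorm_le => s; rewrite [Dn _ _ _]smulE normrM.
by apply: ler_pM => //; exact: (Dn_le_seminorm 0 _ s).
Qed.

(** The constant is the sum of the binomial coefficients of the Leibniz formula. *)
Lemma smul_seminorm k x y a b :
  (forall j, (j <= k)%N -> seminorm j x <= a) ->
  (forall j, (j <= k)%N -> seminorm j y <= b) ->
  seminorm k (x ** y) <= 2 ^+ k * (a * b).
Proof.
elim: k x y => [|k IH] x y xa yb.
  rewrite expr0 mul1r (le_trans (smul_seminorm0 x y))//.
  by apply: ler_pM; rewrite ?seminorm_ge0 ?xa ?yb.
rewrite -seminorm_sderiv sderiv_smul (le_trans (seminormD _ _ _))//.
rewrite exprS -mulrA mulr_natl mulr2n lerD//; apply: IH => j jk;
  rewrite ?seminorm_sderiv ?xa ?yb// ltnW//.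
Qed.

(** In the Leibniz formula for the [k]-th derivative of a product, only the two
extreme terms contain derivatives of order [k]. The sharp constant [1] in
front of these terms is what allows bounds of arbitrarily high order to be
treated with a single smallness condition on the bound of order [0]. *)
Lemma smul_seminorm_top k x y a b : 0 <= a -> 0 <= b ->
  (forall j, (j < k)%N -> seminorm j x <= a) ->
  (forall j, (j < k)%N -> seminorm j y <= b) ->
  seminorm k (x ** y) <=
    seminorm 0 x * seminorm k y + seminorm k x * seminorm 0 y + 4 ^+ k * (a * b).
Proof.
move=> a0 b0.
have ab0 : 0 <= a * b by exact: mulr_ge0.
elim: k x y => [|k IH] x y xa yb.
  have := smul_seminorm0 x y; rewrite expr0 mul1r.
  by have : 0 <= seminorm 0 x * seminorm 0 y;
    [rewrite mulr_ge0 ?seminorm_ge0|lra].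
rewrite -seminorm_sderiv sderiv_smul (le_trans (seminormD _ _ _))//.
have [k0|k0] := posnP k.
  rewrite {}k0 in IH xa yb *.
  have := smul_seminorm0 (sderiv x) y; have := smul_seminorm0 x (sderiv y).
  rewrite !seminorm_sderiv expr1.
  by lra.
have h1 : seminorm k (sderiv x ** y) <=
    a * b + seminorm k.+1 x * seminorm 0 y + 4 ^+ k * (a * b).
  apply: le_trans (IH _ _ _ _) _ => [j jk|j jk|].
  - by rewrite seminorm_sderiv xa.
  - by rewrite yb// ltnW.
  rewrite !seminorm_sderiv lerD2r lerD2r.
  by apply: ler_pM; rewrite ?seminorm_ge0 ?xa ?yb.
have h2 : seminorm k (x ** sderiv y) <=
    seminorm 0 x * seminorm k.+1 y + a * b + 4 ^+ k * (a * b).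
  apply: le_trans (IH _ _ _ _) _ => [j jk|j jk|].
  - by rewrite xa// ltnW.
  - by rewrite seminorm_sderiv yb.
  rewrite !seminorm_sderiv lerD2r lerD2l.
  by apply: ler_pM; rewrite ?seminorm_ge0 ?xa ?yb.
have h3 : a * b <= 4 ^+ k * (a * b).
  by rewrite -[leLHS]mul1r ler_wpM2r// exprn_ege1// ler1n.
rewrite exprS -mulrA.
move: h1 h2 h3; set p := a * b; set q := 4 ^+ k * p.
by lra.
Qed.

Lemma seminorm_bound k x :
  exists2 M, 0 < M & forall j, (j <= k)%N -> seminorm j x <= M.
Proof. exact: finite_majorant (fun j => seminorm j x) k. Qed.

Lemma smul_continuous x : continuous (smul x).
Proof.
move=> y; apply/(@cvg_seminormP R _ (nbhs y) (smul x) _ (nbhs_filter y)) => k e e0.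
have [M M0 xM] := seminorm_bound k x.
have c0 : 0 < 2 ^+ k * M by rewrite mulr_gt0// exprn_gt0.
have d0 : 0 < e / (2 ^+ k * M) / 2 by rewrite !divr_gt0.
have := nbhs_seminorm_ball y k d0; apply: filterS => z yz.
rewrite -smulBr.
have h j : (j <= k)%N -> seminorm j (z - y) <= e / (2 ^+ k * M) / 2.
  by move=> /yz/ltW.
apply: le_lt_trans (smul_seminorm xM h) _.
suff -> : 2 ^+ k * (M * (e / (2 ^+ k * M) / 2)) = e / 2 by lra.
rewrite mulrA mulrA [2 ^+ k * M * _]mulrC divfK ?gt_eqF//.
Qed.

Lemma smoothI_cst (c : R) : smoothI (fun=> c : R).
Proof.
have d0 : diffquotI (fun=> c) = (fun _ _ => 0) :> (unitI R -> unitI R -> R).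
  by apply/funext => s; apply/funext => t; rewrite /diffquotI subrr mul0r.
case=> [|n].
  by move=> s; apply/cvg_ex; exists 0; rewrite d0; exact: cvg_cst.
rewrite iterSr (_ : derivI _ = fun=> 0); first exact: smoothI0.
by apply/funext => s; apply: derivI_cvg; rewrite d0; exact: cvg_cst.
Qed.

Lemma sconst_subproof (c : R) : ((fun=> c) : unitI R -> R^o) \in @smoothIb R.
Proof. by apply/asboolP; exact: smoothI_cst. Qed.

Definition sconst (c : R) : E := SmoothFun (sconst_subproof c).

Lemma sderiv_sconst c : sderiv (sconst c) = 0.
Proof.
apply: smoothfun_eq => s; apply: derivI_cvg.
rewrite (_ : diffquotI _ _ = fun=> 0); first exact: cvg_cst.
by apply/funext => t; rewrite /diffquotI subrr mul0r.
Qed.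

Lemma smoothI_inv (x : unitI R -> R) : smoothI x -> (forall s, x s != 0) ->
  smoothI (fun s => (x s)^-1).
Proof.
move=> sx x0; have dx := sx 0%N.
have h s : diffquotI (fun t => (x t)^-1) s @ s^' -->
    -1 * derivI x s * ((x s)^-1 * (x s)^-1).
  rewrite (_ : diffquotI _ _ =
      fun t => -1 * diffquotI x s t * ((x t)^-1 * (x s)^-1)); last first.
    apply/funext => t; rewrite /diffquotI.
    have [->|ts] := eqVneq t s; first by rewrite !subrr !mul0r mulr0 mul0r.
    field; rewrite !x0 /= subr_eq0.
    by apply: contra ts => /eqP /val_inj ->.
  apply: cvgM; first by apply: cvgM; [exact: cvg_cst|exact: derivableI_cvg].
  apply: cvgM; last exact: cvg_cst.
  apply: cvgV => //; apply: cvg_within_filter.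
  exact: derivableI_continuous.
apply/smoothI_CkI; elim=> // n IH; split.
  by move=> s; apply/cvg_ex; eexists; exact: h.
rewrite (_ : derivI _ = fun s => -1 * derivI x s * ((x s)^-1 * (x s)^-1)).
  apply: CkIM; last exact: CkIM.
  apply: CkIM; first by move: n {IH}; apply/smoothI_CkI; exact: smoothI_cst.
  by have /smoothI_CkI/(_ n.+1)[] := sx.
by apply/funext => s; exact: derivI_cvg.
Qed.

Lemma sinv_subproof x : (forall s, x s != 0) ->
  (fun s => (x s)^-1 : R^o) \in @smoothIb R.
Proof.
move=> x0; apply/asboolP; apply: smoothI_inv => //; exact: smoothfunP.
Qed.

Definition sinv x (x0 : forall s, x s != 0) : E := SmoothFun (sinv_subproof x0).

Lemma smulVK x (x0 : forall s, x s != 0) y : sinv x0 ** (x ** y) = y.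
Proof.
by apply: smoothfun_eq => s; rewrite !smulE /= mulrA mulVf ?mul1r.
Qed.

Lemma smulKV x (x0 : forall s, x s != 0) y : x ** (sinv x0 ** y) = y.
Proof. by rewrite smulA (smulC x) -smulA smulVK. Qed.

End product.

Notation "x ** y" := (smul x y) (at level 40, left associativity).

(** * Estimates for superposition operators *)

Section superposition_estimates.
Variable R : realType.
Notation E := (smoothfun R).
Implicit Types (x y z v : E) (s : unitI R) (g : unitI R * R -> R).

(** Compactness of [[0, 1] x [-M, M]]. *)
Lemma continuous_bounded_strip g (M : R) : continuous g ->
  exists2 K : R, 0 < K & forall s (e : R), `|e| <= M -> `|g (s, e)| <= K.
Proof.
move=> cg; pose G (p : R * R) := g (clampI p.1, p.2).
have cG : continuous G.
  move=> [a b].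
  apply: (@continuous_comp _ _ _ (fun p : R * R => (clampI p.1, p.2)) g);
    last exact: cg.
  move=> U [[A B] [/= Aa Bb] AB]; exists (@clampI R @^-1` A, B) => /=.
    by split=> //; exact: clampI_continuous.
  by move=> [p q] [/= Ap Bq]; exact: AB.
have cK : compact (`[0, 1]%classic `*` `[- M, M]%classic : set (R * R)).
  by apply: compact_setX; exact: segment_compact.
have /compact_bounded[K [_ KG]] :
    compact (G @` (`[0, 1]%classic `*` `[- M, M]%classic)).
  by apply: continuous_compact cK; exact: continuous_subspaceT.
exists (Num.max 1 (K + 1)); first by rewrite lt_max ltr01.
move=> s e eM; rewrite -[s]clampIK.
have h : (G @` (`[0, 1]%classic `*` `[- M, M]%classic)) (G (set_val s, e)).
  exists (set_val s, e) => //; split => /=; rewrite in_itv /=.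
    exact: unitI_itv.
  by rewrite -ler_norml.
by apply: KG h; rewrite lt_max ltrDl ltr01 orbT.
Qed.

Lemma MVT_near (f : R -> R) (a b : R) : (forall r, derivable f r 1) ->
  exists2 c, `|c - a| <= `|b - a| & f b - f a = derive1 f c * (b - a).
Proof.
move=> df.
have main p q : p <= q ->
    exists2 c, p <= c <= q & f q - f p = derive1 f c * (q - p).
  move=> pq; have [||c + fE] := @MVT_segment R f (derive1 f) p q pq.
  - by move=> r _; rewrite derive1E; exact: derivableP.
  - apply: continuous_subspaceT => r.
    by apply: differentiable_continuous; exact/derivable1_diffP.
  by rewrite in_itv => pcq; exists c.
have [ab|/ltW ba] := leP a b.
  have [c /andP[ac cb] fE] := main _ _ ab; exists c => //.
  by rewrite !ger0_norm; lra.
have [c /andP[ac cb] fE] := main _ _ ba; exists c; last lra.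
by rewrite !ler0_norm; lra.
Qed.

Lemma MVT_partial2 g s (a b : R) : cont_partially_diff g ->
  exists2 c, `|c - a| <= `|b - a| &
    g (s, b) - g (s, a) = partial2 g (s, c) * (b - a).
Proof. by move=> [_ _ dg]; exact: (@MVT_near (fun e => g (s, e)) a b). Qed.

Lemma sderiv_superposition g (sg : smooth2 g) x :
  sderiv (superposition sg x) = superposition (smooth2_partial1 sg) x +
    superposition (smooth2_partial2 sg) x ** sderiv x.
Proof.
apply: smoothfun_eq => s; apply: derivI_cvg.
have [c1 _ _] := sg [:: true].
exact: (@chain_rule R x g s (sg [::]) c1 (@smoothfunP R x 0%N)).
Qed.

Lemma norm_le_seminorm0 x s : `|x s| <= seminorm 0 x.
Proof. exact: (Dn_le_seminorm 0 x s). Qed.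

(** Induction on the order: by the chain rule the derivative of [g (s, y s)] is
a combination of superpositions with the partial derivatives of [g], which
are of the same kind. *)
Lemma seminorm_superposition_bounded k g (sg : smooth2 g) (M : R) :
  exists2 K, 0 < K & forall y, (forall j, (j <= k)%N -> seminorm j y <= M) ->
    forall j, (j <= k)%N -> seminorm j (superposition sg y) <= K.
Proof.
elim: k g sg => [|k IH] g sg.
  have [cg _ _] := sg [::].
  have [K K0 gK] := continuous_bounded_strip M cg.
  exists K => // y yM j; rewrite leqn0 => /eqP->; apply: seminorm_le => s.
  by apply: gK; apply: le_trans (norm_le_seminorm0 _ _) _; exact: yM.
have [K K0 gK] := IH g sg.
have [K1 K10 gK1] := IH _ (smooth2_partial1 sg).
have [K2 K20 gK2] := IH _ (smooth2_partial2 sg).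
exists (Num.max K (K1 + 2 ^+ k * (K2 * M))); first by rewrite lt_max K0.
move=> y yM j; have yk i : (i <= k)%N -> seminorm i y <= M.
  by move=> ik; apply: yM; exact: leqW.
rewrite leq_eqVlt ltnS le_max => /predU1P[->|jk]; apply/orP; last first.
  by left; exact: gK.
right; rewrite -seminorm_sderiv sderiv_superposition (le_trans (seminormD _ _ _))//.
apply: lerD; first exact: gK1.
by apply: smul_seminorm => [|i ik]; [exact: gK2|rewrite seminorm_sderiv yM].
Qed.

(** The derivative of the difference splits as
[(S1 y - S1 x) + (S2 y - S2 x) y' + S2 x (y - x)'], where [S1] and [S2] are
the superpositions with the two partial derivatives of [g]. The estimate for
order [k] involves the seminorms of [y - x] up to order [k] only: no
derivative is lost. *)
Lemma seminorm_superposition_lipschitz k g (sg : smooth2 g) (M : R) :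
  exists2 C, 0 < C & forall x y (d : R),
    (forall j, (j <= k)%N -> seminorm j x <= M) ->
    (forall j, (j <= k)%N -> seminorm j y <= M) ->
    (forall j, (j <= k)%N -> seminorm j (y - x) <= d) ->
    forall j, (j <= k)%N ->
      seminorm j (superposition sg y - superposition sg x) <= C * d.
Proof.
elim: k g sg => [|k IH] g sg.
  have [c2 _ _] := sg [:: false].
  have [K K0 gK] := continuous_bounded_strip (3 * M) c2.
  exists K => // x y d xM yM yxd j; rewrite leqn0 => /eqP->.
  apply: seminorm_le => s; rewrite [Dn _ _ _]smoothfunBE !superpositionE.
  (* The intermediate point is within [2 M] of [x s], whence the strip [3 M]. *)
  have [c cx ->] := MVT_partial2 s (x s) (y s) (sg [::]).
  have yx : `|y s - x s| <= seminorm 0 (y - x) := norm_le_seminorm0 (y - x) s.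
  rewrite normrM; apply: ler_pM => //; last exact: le_trans yx (yxd 0%N _).
  apply: gK.
  have := norm_le_seminorm0 x s; have := norm_le_seminorm0 y s.
  have := xM 0%N isT; have := yM 0%N isT.
  have := ler_normD (c - x s) (x s); rewrite subrK.
  have := ler_normB (y s) (x s); lra.
have [C C0 gC] := IH g sg.
have [C1 C10 gC1] := IH _ (smooth2_partial1 sg).
have [C2 C20 gC2] := IH _ (smooth2_partial2 sg).
have [K2 K20 gK2] := seminorm_superposition_bounded k (smooth2_partial2 sg) M.
pose C' := C1 + 2 ^+ k * (C2 * M) + 2 ^+ k * K2.
exists (Num.max C C'); first by rewrite lt_max C0.
move=> x y d xM yM yxd.
have low z (r : R) : (forall j, (j <= k.+1)%N -> seminorm j z <= r) ->
    forall j, (j <= k)%N -> seminorm j z <= r.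
  by move=> zr j jk; apply: zr; exact: leqW.
have high z (r : R) : (forall j, (j <= k.+1)%N -> seminorm j z <= r) ->
    forall j, (j <= k)%N -> seminorm j (sderiv z) <= r.
  by move=> zr j jk; rewrite seminorm_sderiv zr.
have d0 : 0 <= d by apply: le_trans (yxd 0%N isT); exact: seminorm_ge0.
move=> j; rewrite leq_eqVlt ltnS => /predU1P[->|jk]; last first.
  apply: le_trans (gC x y d (low _ _ xM) (low _ _ yM) (low _ _ yxd) j jk) _.
  by rewrite ler_wpM2r// le_max lexx.
apply: (@le_trans _ _ (C' * d)); last by rewrite ler_wpM2r// le_max lexx orbT.
rewrite -seminorm_sderiv sderivB !sderiv_superposition.
set S1 := superposition (smooth2_partial1 sg).
set S2 := superposition (smooth2_partial2 sg).
rewrite (_ : _ - _ = (S1 y - S1 x) + ((S2 y - S2 x) ** sderiv y +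
    S2 x ** sderiv (y - x))); last first.
  rewrite smulBl sderivB smulBr.
  by apply: smoothfun_eq => s; rewrite !(smoothfunBE, smoothfunDE); ring.
apply: le_trans (seminormD _ _ _) _.
rewrite /C' -addrA mulrDl lerD//.
  exact: (gC1 _ _ _ (low _ _ xM) (low _ _ yM) (low _ _ yxd)).
apply: le_trans (seminormD _ _ _) _; rewrite mulrDl lerD//.
  rewrite -mulrA mulrAC; apply: smul_seminorm; last exact: high.
  exact: (gC2 _ _ _ (low _ _ xM) (low _ _ yM) (low _ _ yxd)).
rewrite -mulrA; apply: smul_seminorm; last exact: high.
exact: (gK2 _ (low _ _ xM)).
Qed.

(** The derivative of order [k + 1] of [g (s, y s)] is [partial2 g (s, y s)]
times that of [y], plus terms in the lower derivatives of [y]. The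
coefficient has order [0], so it can be bounded independently of [k]. *)
Lemma seminorm_superposition_top k g (sg : smooth2 g) (M : R) :
  exists2 K, 0 < K & forall y, (forall j, (j <= k)%N -> seminorm j y <= M) ->
    seminorm k.+1 (superposition sg y) <=
      seminorm 0 (superposition (smooth2_partial2 sg) y) * seminorm k.+1 y + K.
Proof.
have [K1 K10 gK1] := seminorm_superposition_bounded k (smooth2_partial1 sg) M.
have [K2 K20 gK2] := seminorm_superposition_bounded k (smooth2_partial2 sg) M.
have M' : 0 <= `|M| by [].
have KM : 0 <= K2 * `|M| by rewrite mulr_ge0// ltW.
have KM4 : 0 <= 4 ^+ k * (K2 * `|M|) by rewrite mulr_ge0// exprn_ge0.
exists (K1 + (K2 * `|M| + 4 ^+ k * (K2 * `|M|))); first by lra.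
move=> y yM.
have yM' j : (j <= k)%N -> seminorm j y <= `|M|.
  by move=> jk; apply: le_trans (yM j jk) (ler_norm _).
rewrite -seminorm_sderiv sderiv_superposition (le_trans (seminormD _ _ _))//.
have := gK1 y yM k (leqnn _).
suff : seminorm k (superposition (smooth2_partial2 sg) y ** sderiv y) <=
    seminorm 0 (superposition (smooth2_partial2 sg) y) * seminorm k.+1 y +
    (K2 * `|M| + 4 ^+ k * (K2 * `|M|)) by lra.
(* For [k = 0] the derivative [y'] has order [1] and is not bounded by [M], but
   the product has a single term. *)
have [k0|k0] := posnP k.
  rewrite {}k0 in KM4 *; apply: le_trans (smul_seminorm0 _ _) _.
  by rewrite seminorm_sderiv; lra.
have hx j : (j < k)%N -> seminorm j (superposition (smooth2_partial2 sg) y) <= K2.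
  by move=> /ltnW; exact: gK2.
have hy j : (j < k)%N -> seminorm j (sderiv y) <= `|M|.
  by move=> jk; rewrite seminorm_sderiv yM'.
apply: le_trans (smul_seminorm_top (ltW K20) M' hx hy) _.
rewrite !seminorm_sderiv -addrA lerD2l lerD2r.
by apply: ler_pM; rewrite ?seminorm_ge0// ?gK2// yM'.
Qed.

(** Two applications of the mean value theorem in the second variable. *)
Lemma taylor_seminorm0 g (sg : smooth2 g) x v :
  exists2 C, 0 < C & forall t : R, `|t| <= 1 ->
    seminorm 0 (superposition sg (x + t *: v) - superposition sg x -
      t *: (superposition (smooth2_partial2 sg) x ** v)) <= C * t ^+ 2.
Proof.
have [c22 _ _] := sg [:: false; false].
pose M := seminorm 0 x + seminorm 0 v.
have [K K0 gK] := continuous_bounded_strip M c22.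
exists (K * (seminorm 0 v + 1) ^+ 2).
  by rewrite mulr_gt0// exprn_gt0// ltr_wpDl// seminorm_ge0.
move=> t t1; apply: seminorm_le => s.
rewrite [Dn _ _ _]smoothfunBE smoothfunBE smoothfunZE smulE !superpositionE.
rewrite smoothfunDE smoothfunZE.
have [c cx ->] := MVT_partial2 s (x s) (x s + t * v s) (sg [::]).
have [c' cx' h] := MVT_partial2 s (x s) c (sg [:: false]).
have {cx}tv : `|c - x s| <= `|t| * seminorm 0 v.
  apply: le_trans cx _; rewrite addrC addKr normrM.
  by rewrite ler_wpM2l// norm_le_seminorm0.
have c'M : `|c'| <= M.
  have := ler_normD (c' - x s) (x s); rewrite subrK.
  have : `|t| * seminorm 0 v <= 1 * seminorm 0 v.
    by rewrite ler_wpM2r// seminorm_ge0.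
  have := norm_le_seminorm0 x s; rewrite /M; lra.
rewrite (_ : _ - _ = (partial2 g (s, c) - partial2 g (s, x s)) * (t * v s));
  last by ring.
rewrite [X in X * _]h !normrM.
have v0 := seminorm_ge0 0 v.
apply: (@le_trans _ _ (K * (`|t| * seminorm 0 v) * (`|t| * seminorm 0 v))).
  apply: ler_pM; rewrite ?mulr_ge0//.
    by apply: ler_pM => //; exact: gK.
  by rewrite ler_wpM2l// norm_le_seminorm0.
rewrite -(real_normK (num_real t)).
rewrite (_ : K * _ * _ = K * `|t| ^+ 2 * seminorm 0 v ^+ 2); last by ring.
rewrite [leRHS]mulrAC ler_wpM2l//; first by rewrite mulr_ge0// ?sqr_ge0// ltW.
by rewrite ler_sqr ?nnegrE//; lra.
Qed.

(** The difference quotients of [g] in the second variable converge to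
[partial2 g] uniformly in the first one, and so do those of [partial1 g] to
[partial2 (partial1 g)]; the derivative of the limit is the limit of the
derivatives. The quotients are taken as superpositions at constant
functions. *)
Lemma partialC g : smooth2 g -> partial1 (partial2 g) = partial2 (partial1 g).
Proof.
move=> sg; apply/funext => -[s e].
pose h n : R := n.+1%:R^-1.
have h0 n : h n != 0 by rewrite invr_eq0.
pose u n : E := (h n)^-1 *: (superposition sg (sconst e + h n *: sconst 1) -
  superposition sg (sconst e)).
have quot_cvg g' (sg' : smooth2 g') :
    unif_cvg (fun n => (h n)^-1 *: (superposition sg' (sconst e + h n *: sconst 1) -
      superposition sg' (sconst e)) : E)
    (superposition (smooth2_partial2 sg') (sconst e)).
  have [C C0 gC] := taylor_seminorm0 sg' (sconst e) (sconst 1).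
  move=> r r0; pose N := Num.truncn (C / r); exists N => n Nn s'.
  have hn0 : 0 < h n by rewrite invr_gt0.
  have hn1 : `|h n| <= 1 by rewrite gtr0_norm// invf_le1// ler1n.
  set w := superposition _ _ - _.
  have -> : superposition (smooth2_partial2 sg') (sconst e) =
      superposition (smooth2_partial2 sg') (sconst e) ** sconst 1.
    by apply: smoothfun_eq => ?; rewrite smulE mulr1.
  set p := _ ** _.
  apply: (@le_lt_trans _ _ (seminorm 0 ((h n)^-1 *: (w - h n *: p)))).
    rewrite (scalerBr _ w) scalerA mulVf// scale1r.
    exact: (norm_le_seminorm0 ((h n)^-1 *: w - p) s').
  rewrite seminormZE normfV gtr0_norm// ltr_pdivrMl//.
  apply: le_lt_trans (gC _ hn1) _.
  rewrite expr2 mulrA mulrC ltr_pM2l// /h ltr_pdivrMr//.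
  rewrite mulrC -ltr_pdivrMr//.
  by apply: lt_le_trans (truncnS_gt _) _; rewrite ler_nat ltnS.
apply: derivI_cvg.
apply: (@unif_cvg_derivI R (fun n => u n) _
  (superposition (smooth2_partial2 (smooth2_partial1 sg)) (sconst e))).
- by move=> n; exact: (@smoothfunP R (u n) 0%N).
- exact: quot_cvg.
- have := quot_cvg _ (smooth2_partial1 sg).
  rewrite (_ : (fun n => _) = (fun n => derivI (u n)))//.
  apply/funext => n; rewrite -[derivI (u n)]/(sderiv (u n) : unitI R -> R).
  congr smoothfun_val.
  rewrite /u sderivZ sderivB !sderiv_superposition.
  rewrite sderivD sderivZ !sderiv_sconst scaler0 addr0.
  congr (_ *: _); apply: smoothfun_eq => s'.
  by rewrite !(smoothfunBE, smoothfunDE, smulE) !mulr0 !addr0.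
Qed.

(** Differentiating the remainder gives the remainders of both partial
derivatives of [g], and a product of an increment with [t v']; the equality
of mixed partial derivatives makes the linear terms match. *)
Lemma taylor_seminorm k g (sg : smooth2 g) x v :
  exists2 C, 0 < C & forall t : R, `|t| <= 1 ->
    seminorm k (superposition sg (x + t *: v) - superposition sg x -
      t *: (superposition (smooth2_partial2 sg) x ** v)) <= C * t ^+ 2.
Proof.
suff [C C0 gC] : exists2 C, 0 < C & forall t : R, `|t| <= 1 ->
    forall j, (j <= k)%N ->
    seminorm j (superposition sg (x + t *: v) - superposition sg x -
      t *: (superposition (smooth2_partial2 sg) x ** v)) <= C * t ^+ 2.
  by exists C => // t t1; exact: gC.
elim: k g sg => [|k IH] g sg.
  have [C C0 gC] := taylor_seminorm0 sg x v; exists C => // t t1 j.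
  by rewrite leqn0 => /eqP->; exact: gC.
have [C C0 gC] := IH g sg.
have [C1 C10 gC1] := IH _ (smooth2_partial1 sg).
have [C2 C20 gC2] := IH _ (smooth2_partial2 sg).
have [X X0 xX] := seminorm_bound k.+1 x.
have [V V0 vV] := seminorm_bound k.+1 v.
have [L L0 gL] := seminorm_superposition_lipschitz k (smooth2_partial2 sg) (X + V).
pose C' := C1 + 2 ^+ k * (C2 * X) + 2 ^+ k * (L * V * V).
exists (Num.max C C'); first by rewrite lt_max C0.
move=> t t1 j; rewrite leq_eqVlt ltnS => /predU1P[->|jk]; last first.
  apply: le_trans (gC t t1 j jk) _.
  by rewrite ler_wpM2r ?sqr_ge0// le_max lexx.
apply: (@le_trans _ _ (C' * t ^+ 2)); last first.
  by rewrite ler_wpM2r ?sqr_ge0// le_max lexx orbT.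
set S1 := superposition (smooth2_partial1 sg).
set S2 := superposition (smooth2_partial2 sg).
set S21 := superposition (smooth2_partial2 (smooth2_partial1 sg)).
set S22 := superposition (smooth2_partial2 (smooth2_partial2 sg)).
have mixed : superposition (smooth2_partial1 (smooth2_partial2 sg)) x = S21 x.
  by apply: smoothfun_eq => s; rewrite !superpositionE partialC.
rewrite -seminorm_sderiv sderivB sderivB sderivZ sderiv_smul !sderiv_superposition mixed.
rewrite -/S1 -/S2 -/S22 sderivD sderivZ.
rewrite (_ : _ - _ = (S1 (x + t *: v) - S1 x - t *: (S21 x ** v)) +
   ((S2 (x + t *: v) - S2 x - t *: (S22 x ** v)) ** sderiv x +
    (S2 (x + t *: v) - S2 x) ** (t *: sderiv v))); last first.
  apply: smoothfun_eq => s.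
  by rewrite !(smoothfunBE, smoothfunDE, smulE, smoothfunZE); ring.
apply: le_trans (seminormD _ _ _) _.
rewrite /C' -(addrA C1) mulrDl lerD//; first exact: gC1.
apply: le_trans (seminormD _ _ _) _; rewrite mulrDl lerD//.
  rewrite -mulrA mulrAC; apply: smul_seminorm; first exact: gC2.
  by move=> i ik; rewrite seminorm_sderiv xX.
have tvV i : (i <= k.+1)%N -> seminorm i (t *: v) <= `|t| * V.
  by move=> ik; rewrite seminormZE ler_wpM2l// vV.
rewrite (_ : _ * t ^+ 2 = 2 ^+ k * (L * (`|t| * V) * (`|t| * V))); last first.
  by rewrite -(real_normK (num_real t)); ring.
apply: smul_seminorm; last first.
  by move=> i ik; rewrite seminormZE seminorm_sderiv ler_wpM2l// vV.
apply: gL => i ik.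
- apply: le_trans (xX _ (leqW ik)) _; lra.
- apply: le_trans (seminormD _ _ _) _; apply: lerD; first exact: xX (leqW ik).
  apply: le_trans (tvV _ (leqW ik)) _.
  by rewrite ler_piMl// ltW.
- by rewrite addrC addKr; exact: tvV (leqW ik).
Qed.

End superposition_estimates.

(** * The Gateaux derivative of a superposition operator *)

Section derivative_of_superposition.
Variables (R : realType) (g : unitI R * R -> R) (sg : smooth2 g).
Notation E := (smoothfun R).
Implicit Types (x y v w : E).

Lemma gateaux_quotient_superposition x v :
  gateaux_quotient (superposition sg) x v t @[t --> (0 : R)^'] -->
    superposition (smooth2_partial2 sg) x ** v.
Proof.
apply/cvg_seminormP => k e e0.
have [C C0 gC] := taylor_seminorm k sg x v.
near=> t.
have t0 : t != 0 by near: t; exact: nbhs_dnbhs_neq.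
have tle : `|t| < Num.min 1 (e / C).
  by near: t; apply: dnbhs0_lt; rewrite lt_min ltr01 divr_gt0.
move: tle; rewrite lt_min => /andP[t1 te].
rewrite /gateaux_quotient; set p := _ ** v; set q := _ - superposition sg x.
rewrite (_ : _ - p = t^-1 *: (q - t *: p)); last first.
  by rewrite (scalerBr _ q) scalerA mulVf// scale1r.
rewrite seminormZE normfV ltr_pdivrMl ?normr_gt0//.
apply: le_lt_trans (gC t (ltW t1)) _.
rewrite -(real_normK (num_real t)) expr2 mulrCA ltr_pM2l ?normr_gt0//.
by rewrite mulrC -ltr_pdivlMr.
Unshelve. all: by end_near. Qed.

Lemma gderiv_superposition x :
  gderiv (superposition sg) x = smul (superposition (smooth2_partial2 sg) x).
Proof.
apply/funext => v; apply: xget_subset1.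
  exact: gateaux_quotient_superposition.
by apply: cvg_unique; exact: smoothfun_hausdorff.
Qed.

Lemma near_line (D : set E) x v : nbhs x D ->
  \forall t \near (0 : R), D (x + t *: v).
Proof.
suff h : x + t *: v @[t --> (0 : R)] --> x by move=> /h.
apply/(@cvg_seminormP R R (nbhs (0 : R)) (fun t => x + t *: v) x _) => k e e0.
have r0 : 0 < e / (seminorm k v + 1).
  by rewrite divr_gt0// ltr_wpDl// seminorm_ge0.
have := @nbhs0_lt R R _ r0; apply: filterS => t te.
rewrite addrC addKr seminormZE.
have v0 := seminorm_ge0 k v.
apply: le_lt_trans (_ : `|t| * (seminorm k v + 1) < e).
  by rewrite ler_wpM2l//; lra.
by rewrite -ltr_pdivlMr//; lra.
Qed.

Lemma superposition_gateaux_differentiable (D : set E) : open D ->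
  gateaux_differentiable D (superposition sg).
Proof.
move=> oD x Dx; split.
- by move=> v; apply: near_line; exact: open_nbhs_nbhs.
- move=> v; exists (superposition (smooth2_partial2 sg) x ** v).
  exact: gateaux_quotient_superposition.
- by move=> a u v; rewrite gderiv_superposition smul_linr.
- by rewrite gderiv_superposition; exact: smul_continuous.
Qed.

Lemma gderiv_superposition_homeomorphism x :
  (forall s, partial2 g (s, x s) != 0) ->
  linear_homeomorphism (gderiv (superposition sg) x).
Proof.
move=> nz; rewrite gderiv_superposition; split.
- by move=> a u v; rewrite smul_linr.
- exact: smul_continuous.
- exists (smul (@sinv R (superposition (smooth2_partial2 sg) x) nz)); split.
  + exact: smulVK.
  + exact: smulKV.
  + exact: smul_continuous.
Qed.

End derivative_of_superposition.

(** * Boxes contracted by a nonlinear multiplier *)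

Section boxes.
Variable R : realType.
Notation E := (smoothfun R).
Implicit Types (c m : nat -> R) (u v w : E).

Definition box c : set E := [set v | forall i, seminorm i v <= c i].

Lemma box_bounded c : vn_bounded (box c).
Proof. by apply/vn_boundedP; exists c => i v. Qed.

Lemma box_closed c : closed (box c).
Proof.
move=> v vc i; apply/ler_addgt0Pr => e e0.
have [w [/(_ i) wc /(_ i (leqnn i)) wv]] := vc _ (nbhs_seminorm_ball v i e0).
have := seminormD i (v - w) w; rewrite subrK seminormB_sym; lra.
Qed.

Lemma box_absolutely_convex c : absolutely_convex (box c).
Proof.
move=> u v a b uc vc ab i; apply: le_trans (seminormD _ _ _) _.
have c0 : 0 <= c i by apply: le_trans (uc i); exact: seminorm_ge0.
rewrite !seminormZE.
apply: (@le_trans _ _ ((`|a| + `|b|) * c i)); last by rewrite ler_piMl.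
by rewrite mulrDl; apply: lerD; rewrite ler_wpM2l.
Qed.

Lemma box_neq0 c : (forall i, 0 < c i) -> box c !=set0.
Proof. by move=> c0; exists 0 => i; rewrite seminorm0 ltW. Qed.

Lemma scaled_box c (t : R) u : 0 < t -> (forall i, seminorm i u <= t * c i) ->
  scaled t (box c) u.
Proof.
move=> t0 uc; exists (t^-1 *: u); last by rewrite scalerA divff ?scale1r ?gt_eqF.
by move=> i; rewrite seminormZE normfV gtr0_norm// ler_pdivrMl.
Qed.

End boxes.

Section contracting_boxes.
Variables (R : realType).
Notation E := (smoothfun R).
Variable g : E -> E.
Implicit Types (c m : nat -> R) (u v w : E).

(** For bounds of order at most [k] the multiplier is Lipschitz at [0], where it
vanishes, without loss of derivatives. *)
Definition small_at_0 := forall k, exists2 C : R, 0 < C & forall (d : R) v,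
  d <= 1 -> (forall j, (j <= k)%N -> seminorm j v <= d) ->
  forall j, (j <= k)%N -> seminorm j (g v) <= C * d.

(** The slope [L] is the same for all orders [i]; only the constant [K] may grow
with [i] and with the bounds of lower order. *)
Definition affine_at_top := exists2 L : R, 0 < L & forall i (M : R),
  exists2 K : R, 0 < K & forall v, seminorm 0 v <= 1 ->
    (forall j, (j < i)%N -> seminorm j v <= M) ->
    seminorm i (g v) <= L * seminorm i v + K.

Hypotheses (g_small : small_at_0) (g_top : affine_at_top).

(** For the orders up to [n] the product [g v ** w] is quadratically small in
[d]. For any order, it is at most [(C' + L) d c] plus a constant depending
on the lower bounds, so that it suffices that [(C' + L) d <= 1/4] and that
[c] exceeds four times this constant. *)
Lemma contraction_threshold (n : nat) (e : R) : 0 < e ->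
  exists2 d, 0 < d <= e &
  [/\ forall v w, (forall j, (j <= n)%N -> seminorm j v <= d) ->
        (forall j, (j <= n)%N -> seminorm j w <= d) ->
        forall i, (i <= n)%N -> seminorm i (g v ** w) <= d / 2 &
      forall i (M : R), exists T, forall (c : R) v w, T <= c ->
        seminorm 0 v <= d -> seminorm 0 w <= d ->
        (forall j, (j < i)%N -> seminorm j v <= M) ->
        (forall j, (j < i)%N -> seminorm j w <= M) ->
        seminorm i v <= c -> seminorm i w <= c ->
        seminorm i (g v ** w) <= c / 2].
Proof.
move=> e0; have [C C0 gC] := g_small n; have [C' C'0 gC'] := g_small 0%N.
have [L L0 gL] := g_top.
have c1 : 0 < (2 ^+ n * C * 2)^-1 by rewrite invr_gt0 !mulr_gt0// exprn_gt0.
have c2 : 0 < ((C' + L) * 4)^-1 by rewrite invr_gt0 mulr_gt0// addr_gt0.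
(* The third bound keeps the derivatives of [g v ** w] up to order [n] below
   [d / 2]; the last one is the smallness needed for all higher orders. *)
pose d := Num.min (Num.min 1 e) (Num.min (2 ^+ n * C * 2)^-1 ((C' + L) * 4)^-1).
have d0 : 0 < d by rewrite !lt_min ltr01 e0 c1.
have d1 : d <= 1 by rewrite !ge_min lexx.
have de : d <= e by rewrite !ge_min lexx orbT.
have dC : d <= (2 ^+ n * C * 2)^-1 by rewrite !ge_min lexx !orbT.
have dL : d <= ((C' + L) * 4)^-1 by rewrite !ge_min lexx !orbT.
exists d; first by rewrite d0.
split=> [v w vd wd i im|i M].
  have hv j : (j <= i)%N -> seminorm j (g v) <= C * d.
    by move=> ji; apply: gC => //; exact: leq_trans im.
  have hw j : (j <= i)%N -> seminorm j w <= d.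
    by move=> ji; apply: wd; exact: leq_trans im.
  apply: le_trans (smul_seminorm hv hw) _.
  apply: (@le_trans _ _ (2 ^+ n * (C * d * d))).
    by rewrite ler_wpM2r ?mulr_ge0 ?(ltW C0) ?(ltW d0)// ler_weXn2l// ler1n.
  rewrite (_ : 2 ^+ n * _ = d * (2 ^+ n * C * d)); last by set q := 2 ^+ n; ring.
  rewrite ler_pM2l//; move: dC; rewrite invfM.
  by rewrite -ler_pdivrMl ?invrK// invr_gt0 mulr_gt0// exprn_gt0.
have /choice[K gK] j : exists K : R, 0 < K /\ forall v, seminorm 0 v <= 1 ->
    (forall j', (j' < j)%N -> seminorm j' v <= M) ->
    seminorm j (g v) <= L * seminorm j v + K.
  by have [K K0 gK] := gL j M; exists K.
have [Km Km0 KKm] := finite_majorant K i.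
pose a := L * `|M| + Km.
have a0 : 0 <= a by rewrite addr_ge0 ?mulr_ge0// ltW.
exists (4 * (Km * d + 4 ^+ i * (a * `|M|))) => c v w Tc v0 w0 vM wM vc wc.
have low j : (j < i)%N -> seminorm j (g v) <= a.
  move=> ji; have [_ h] := gK j.
  apply: le_trans (h v _ _) _; first exact: le_trans d1.
    by move=> j' j'j; apply: vM; exact: ltn_trans ji.
  apply: lerD; last exact: KKm (ltnW ji).
  by rewrite ler_pM2l//; apply: le_trans (vM j ji) (ler_norm _).
have lowM j : (j < i)%N -> seminorm j w <= `|M|.
  by move=> ji; apply: le_trans (wM j ji) (ler_norm _).
apply: le_trans (smul_seminorm_top a0 (normr_ge0 M) low lowM) _.
have c0 : 0 <= c by apply: le_trans vc; exact: seminorm_ge0.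
have g0 : seminorm 0 (g v) <= C' * d.
  by apply: gC' => // j; rewrite leqn0 => /eqP->.
have gi : seminorm i (g v) <= L * c + Km.
  have [_ h] := gK i; apply: le_trans (h v _ vM) _; first exact: le_trans d1.
  by apply: lerD; rewrite ?ler_pM2l// KKm.
have h1 : seminorm 0 (g v) * seminorm i w <= C' * d * c.
  by apply: ler_pM; rewrite ?seminorm_ge0.
have h2 : seminorm i (g v) * seminorm 0 w <= (L * c + Km) * d.
  by apply: ler_pM; rewrite ?seminorm_ge0.
have h3 : (C' + L) * d * c <= c / 4.
  rewrite mulrC ler_wpM2l//; move: dL.
  by rewrite invfM -ler_pdivrMl ?invrK// invr_gt0 addr_gt0.
set q := 4 ^+ i * _ in Tc *.
by move: Tc h1 h2 h3; rewrite !mulrDl !mulrDr; lra.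
Qed.

(** The common bound [d] up to order [n] keeps [x + 2 v] in the given
neighborhood of [x]; positivity and the third condition put [x] in the span
of the box; the last condition is the contraction with factor [1/2]. *)
Definition contracting (x : E) n (d : R) c :=
  [/\ forall i, 0 < c i, forall i, (i <= n)%N -> c i = d,
      forall i, (n < i)%N -> seminorm i x <= c i &
      forall v w, box c v -> box c w -> box c (2 *: (g v ** w))].

(** The bounds above order [n] are defined recursively; the sum of all previous
bounds majorizes each of them and serves as [M] in the threshold. As the
bound of order [i] may be enlarged, it can be taken above any prescribed
[m i], which yields directedness and absorption. *)
Lemma contracting_box_ex (x : E) n (e : R) : 0 < e ->
  exists2 d, 0 < d <= e & forall m, exists2 c, contracting x n d c &
    forall i, (n < i)%N -> m i <= c i.
Proof.
move=> e0; have [d /andP[d0 de] [small large]] := contraction_threshold n e0.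
exists d; first by rewrite d0.
have /choice[T TP] (p : nat * R) : exists T, forall (c : R) v w, T <= c ->
        seminorm 0 v <= d -> seminorm 0 w <= d ->
        (forall j, (j < p.1)%N -> seminorm j v <= p.2) ->
        (forall j, (j < p.1)%N -> seminorm j w <= p.2) ->
        seminorm p.1 v <= c -> seminorm p.1 w <= c ->
        seminorm p.1 (g v ** w) <= c / 2.
  exact: large.
move=> m.
pose F i s := if (i <= n)%N then d else
  Num.max (Num.max d (m i)) (Num.max (seminorm i x) (T (i, s))).
(* [S i] is the sum of the bounds [c j] for [j < i]. *)
pose S := fix S i := if i is i'.+1 then S i' + F i' (S i') else 0.
pose c i := F i (S i).
have c0 i : 0 < c i.
  by rewrite /c /F; case: ifP => // _; rewrite !lt_max d0.
have cS i j : (j < i)%N -> c j <= S i.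
  have S0 k : 0 <= S k by elim: k => //= k IH; rewrite addr_ge0// ltW// c0.
  elim: i => // i IH; rewrite ltnS leq_eqVlt => /predU1P[->|/IH ji] /=.
    by rewrite lerDr.
  by apply: le_trans ji _; rewrite lerDl ltW// c0.
have cn i : (i <= n)%N -> c i = d by rewrite /c /F => ->.
have cE i : (n < i)%N -> c i =
    Num.max (Num.max d (m i)) (Num.max (seminorm i x) (T (i, S i))).
  by rewrite /c /F ltnNge => /negbTE->.
exists c; last by move=> i ni; rewrite cE// !le_max lexx !orbT.
split=> // [i ni|v w vc wc i]; first by rewrite cE// !le_max lexx !orbT.
rewrite seminormZE gtr0_norm// -ler_pdivlMl// mulrC.
have low u : box c u -> forall j, (j <= n)%N -> seminorm j u <= d.
  by move=> uc j jn; rewrite -(cn j jn).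
have [ni|ni] := leqP i n.
  by rewrite (cn i ni); apply: small => //; exact: low.
apply: (TP (i, S i)) => //=.
- by rewrite cE// !le_max lexx !orbT.
- by move=> j ji; exact: le_trans (vc j) (cS _ _ ji).
- by move=> j ji; exact: le_trans (wc j) (cS _ _ ji).
Qed.

(** A common majorant of two contracting boxes, or a dilated box containing a
bounded set, is obtained by prescribing the bounds above order [n]; up to
order [n] all boxes agree, and a dilation takes care of the bounded set. *)
Lemma contracting_boxes_generator (x : E) n (d : R) : 0 < d ->
  (forall m, exists2 c, contracting x n d c &
    forall i, (n < i)%N -> m i <= c i) ->
  bornological_generator [set box c | c in contracting x n d].
Proof.
move=> d0 ex; split.
- move=> _ [c [c0 _ _ _] <-]; split.
  + exact: box_neq0.
  + exact: box_bounded.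
  + exact: box_closed.
  + exact: box_absolutely_convex.
- move=> _ _ [c cc <-] [c' cc' <-].
  have [c'' cc'' cle] := ex (fun i => Num.max (c i) (c' i)).
  exists (box c''); first by exists c''.
  have [_ cn _ _] := cc; have [_ cn' _ _] := cc'; have [_ cn'' _ _] := cc''.
  move=> u [uc|uc] i; apply: le_trans (uc i) _;
    (have [ni|ni] := leqP i n; first by rewrite ?cn ?cn' ?cn'');
    by apply: le_trans (cle i ni); rewrite le_max lexx ?orbT.
- move=> A /vn_boundedP[m Am].
  have [c cc mc] := ex m; have [c0 cn _ _] := cc.
  have [M M0 mM] := finite_majorant m n.
  have t0 : 0 < M / d + 1 by rewrite addr_gt0// divr_gt0.
  exists (M / d + 1); split=> //; exists (box c); first by exists c.
  move=> u Au; apply: scaled_box => // i; apply: le_trans (Am i u Au) _.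
  have [ni|ni] := leqP i n.
    by rewrite cn// mulrDl divfK ?gt_eqF// mul1r; have := mM i ni; lra.
  apply: le_trans (mc i ni) _; rewrite ler_peMl ?(ltW (c0 i))//.
  by rewrite lerDr divr_ge0 ?ltW.
Qed.

Lemma cone_span_contracting (x v : E) n (d : R) c : 0 < d ->
  contracting x n d c -> box c v -> cone_span (box c) (x + 2 *: v).
Proof.
move=> d0 [c0 cn cx _] vc.
have [X X0 xX] := seminorm_bound n x.
(* [X / d] absorbs [x] up to order [n], [1] above it, and [2] absorbs [2 v]. *)
have t0 : 0 < X / d by rewrite divr_gt0.
have t3 : 0 < X / d + 3 by lra.
suff [w wc <-] : scaled (X / d + 3) (box c) (x + 2 *: v).
  by exists (X / d + 3); split => //; exists w.
apply: scaled_box => // i; apply: le_trans (seminormD _ _ _) _.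
rewrite seminormZE gtr0_norm//.
have vi := vc i; have ci := c0 i.
have Xc : 0 <= X / d * c i by rewrite mulr_ge0// ltW.
suff : seminorm i x <= (X / d + 1) * c i by rewrite !mulrDl; lra.
rewrite mulrDl mul1r; have [ni|ni] := leqP i n.
  by rewrite cn// divfK ?gt_eqF//; have := xX i ni; lra.
by have := cx i ni; lra.
Qed.

End contracting_boxes.

(** * The multiplier attached to a superposition operator *)

Section multiplier.
Variables (R : realType) (g : unitI R * R -> R) (sg : smooth2 g).
Notation E := (smoothfun R).
Variables (x b : E).
Implicit Types (v w : E).

(** With [b = 1 / A x], the derivative at [x + 2 v] minus the derivative at [x]
is [relative_increment v] times the derivative at [x]. *)
Definition relative_increment v : E :=
  b ** (superposition sg (x + 2 *: v) - superposition sg x).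

Lemma relative_increment_small : small_at_0 relative_increment.
Proof.
move=> k; have [X X0 xX] := seminorm_bound k x.
have [B B0 bB] := seminorm_bound k b.
have [C C0 gC] := seminorm_superposition_lipschitz k sg (X + 2).
exists (2 ^+ k * (B * (C * 2))); first by rewrite !mulr_gt0// exprn_gt0.
move=> d v d1 vd j jk.
have d0 : 0 <= d by apply: le_trans (vd 0%N isT); exact: seminorm_ge0.
have v2 i : (i <= k)%N -> seminorm i (2 *: v) <= 2 * d.
  by move=> ik; rewrite seminormZE gtr0_norm// ler_pM2l// vd.
have h i : (i <= j)%N -> seminorm i (superposition sg (x + 2 *: v) -
    superposition sg x) <= C * (2 * d).
  move=> ij; apply: gC (leq_trans ij jk) => l lk.
  - by have := xX l lk; lra.
  - apply: le_trans (seminormD _ _ _) _.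
    by have := xX l lk; have := v2 l lk; lra.
  - by rewrite addrC addKr v2.
have hb i : (i <= j)%N -> seminorm i b <= B.
  by move=> ij; apply: bB; exact: leq_trans jk.
apply: le_trans (smul_seminorm hb h) _.
set q := 2 ^+ k; rewrite (_ : q * (B * (C * 2)) * d = q * (B * (C * (2 * d))));
  last by ring.
by rewrite /q ler_wpM2r ?ler_weXn2l ?ler1n// !mulr_ge0// ltW.
Qed.

(** The slope is [2 |b|_0] times a bound of [partial2 g] on a strip containing
the graphs of all [x + 2 v] with [|v|_0 <= 1]. *)
Lemma relative_increment_top : affine_at_top relative_increment.
Proof.
pose X0 := seminorm 0 x.
have [L0 L00 gL0] :=
  seminorm_superposition_bounded 0 (smooth2_partial2 sg) (X0 + 2).
have [C C0 gC] := relative_increment_small 0.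
have b0 := seminorm_ge0 0 b.
exists (seminorm 0 b * (L0 * 2) + 1).
  by rewrite ltr_wpDl// mulr_ge0// mulr_ge0// ltW.
case=> [|k] M.
  exists C => // v v1 _; apply: le_trans (gC 1 v _ _ 0%N _) _ => //.
    by move=> j; rewrite leqn0 => /eqP->.
  rewrite mulr1 lerDr mulr_ge0 ?seminorm_ge0// addr_ge0// mulr_ge0// mulr_ge0//.
  exact: ltW.
have [X _ xX] := seminorm_bound k.+1 x.
have [B B0 bB] := seminorm_bound k.+1 b.
have [Y Y0 gY] := seminorm_bound k.+1 (superposition sg x).
have [H H0 gH] := seminorm_superposition_bounded k sg (X + 2 * M).
have [K K0 gK] := seminorm_superposition_top k sg (X + 2 * M).
have HY : 0 < H + Y by exact: addr_gt0.
pose K1 := seminorm 0 b * (L0 * X + K + Y) + B * (H + Y) +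
  4 ^+ k.+1 * (B * (H + Y)).
exists (`|K1| + 1); first by rewrite ltr_wpDl.
move=> v v1 vM.
set y := x + 2 *: v; set h := superposition sg y - superposition sg x.
have yM j : (j <= k)%N -> seminorm j y <= X + 2 * M.
  move=> jk; apply: le_trans (seminormD _ _ _) _; apply: lerD.
    exact: xX (leqW jk).
  by rewrite seminormZE gtr0_norm// ler_pM2l// vM.
have y0 : seminorm 0 y <= X0 + 2.
  apply: le_trans (seminormD _ _ _) _; rewrite lerD2l.
  by rewrite seminormZE gtr0_norm//; lra.
have hj j : (j < k.+1)%N -> seminorm j h <= H + Y.
  move=> jk; apply: le_trans (seminormD _ _ _) _; rewrite seminormN.
  by apply: lerD; [exact: gH|exact: gY (ltnW jk)].
have hk : seminorm k.+1 h <= L0 * (X + 2 * seminorm k.+1 v) + K + Y.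
  apply: le_trans (seminormD _ _ _) _; rewrite seminormN.
  apply: lerD; last exact: gY.
  apply: le_trans (gK y yM) _; rewrite lerD2r.
  apply: ler_pM; rewrite ?seminorm_ge0//.
    by apply: gL0 => // j; rewrite leqn0 => /eqP->.
  apply: le_trans (seminormD _ _ _) _; apply: lerD; first exact: xX.
  by rewrite seminormZE gtr0_norm.
have bj j : (j < k.+1)%N -> seminorm j b <= B by move=> /ltnW; exact: bB.
apply: le_trans (smul_seminorm_top (ltW B0) (ltW HY) bj hj) _.
have h1 : seminorm 0 b * seminorm k.+1 h <=
    seminorm 0 b * (L0 * (X + 2 * seminorm k.+1 v) + K + Y).
  by rewrite ler_wpM2l.
have h2 : seminorm k.+1 b * seminorm 0 h <= B * (H + Y).
  by apply: ler_pM; rewrite ?seminorm_ge0 ?bB ?hj.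
have := ler_norm K1; have := seminorm_ge0 k.+1 v; rewrite {1}/K1.
move: h1 h2; set q := 4 ^+ k.+1 * _; set p := B * (H + Y).
set r := seminorm k.+1 v; set b' := seminorm 0 b.
rewrite (_ : b' * (L0 * _ + K + Y) = b' * (L0 * X + K + Y) + b' * (L0 * 2) * r);
  last by ring.
by rewrite mulrDl mul1r; lra.
Qed.

End multiplier.

(** * Tameness of superposition operators *)

Theorem proposition10 (R : realType) (phi : unitI R * R -> R)
    (sphi : smooth2 phi)
    (dphi : forall (s : unitI R) (eta : R), partial2 phi (s, eta) <> 0)
    (x : smoothfun R) :
  Colombeau0_tame setT (superposition sphi) x.
Proof.
move=> V oV Vx.
have [n [e e0 eV]] : nbhs x V by exact: open_nbhs_nbhs.
pose A := superposition (smooth2_partial2 sphi).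
have nz s : A x s != 0 by apply/eqP; exact: dphi.
pose b := sinv nz; pose g := relative_increment (smooth2_partial2 sphi) x b.
have e3 : 0 < e / 3 by lra.
have [d /andP[d0 de] ex] := contracting_box_ex
  (@relative_increment_small R _ (smooth2_partial2 sphi) x b)
  (@relative_increment_top R _ (smooth2_partial2 sphi) x b)
  x n e3.
exists [set box c | c in contracting g x n d]; split; last first.
  by apply: gderiv_superposition_homeomorphism => s; exact: nz.
split.
- exact: smoothfun_hausdorff.
- exact: smoothfun_bornological.
- exact: smoothfun_locally_complete.
- by apply: superposition_gateaux_differentiable; rewrite setIT.
- by lra.
- exact: contracting_boxes_generator.
move=> _ [c cc <-] v vc y; have [_ cn _ cg] := cc; split.
- split=> //; apply: eV => i im; rewrite /y addrC addKr seminormZE gtr0_norm//.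
  by have := vc i; rewrite cn//; lra.
- exact: cone_span_contracting cc vc.
move=> _ [w wc <-]; rewrite !gderiv_superposition.
exists (A x ** (2 *: (g v ** w))).
  by exists (2 *: (g v ** w)) => //; exact: cg.
rewrite -smulBl /g /relative_increment -[X in _ = X](smulKV nz).
apply: smoothfun_eq => s; rewrite !(smoothfunZE, smulE).
by rewrite -/b -/y; field.
Qed.
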